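(* Assume that $(n-1)(k-1)>2$ and that $F_{k,n}$ is neither trigonal nor (isomorphic to) a plane quintic. Let $\phi:S\to S_{F_{k,n}}=\bigoplus_{m\geq 0}H^0\left(F_{k,n},\Omega_{F_{k,n}}^{\otimes m}\right)$ be the canonical map, i.e. the homomorphism of graded $K$-algebras determined by $z_{r,\mathbf{a}}\mapsto\theta^{(1)}_{r,\mathbf{a}}$ for $(r,\mathbf{a})\in I_{k,n}^{(1)}$. Then the ideal $\ker\phi$ of $S$ is generated by $\mathcal{G}_{\rm bi}\cup\mathcal{G}_{\rm tri}$, where $$\mathcal{G}_{\rm bi}=\left\{z_{r,\mathbf{a}}z_{s,\mathbf{b}}-z_{t,\mathbf{c}}z_{u,\mathbf{d}}:\ (r+s,\mathbf{a}+\mathbf{b})=(t+u,\mathbf{c}+\mathbf{d})\right\}$$ and $$\mathcal{G}_{\rm tri}=\left\{\lambda_i z_{r,\mathbf{a}}z_{s,\mathbf{b}}+z_{t,\mathbf{c}}z_{u,\mathbf{d}}+z_{v,\mathbf{e}}z_{w,\mathbf{f}}:\ \begin{array}{l}t+u=r+s+k,\ \mathbf{c}+\mathbf{d}=\mathbf{a}+\mathbf{b},\\ v+w=r+s,\ \mathbf{e}+\mathbf{f}=\mathbf{a}+\mathbf{b}-\mathbf{k}(i),\end{array}\ 1\leq i\leq n-1\right\},$$ with all index pairs $(r,\mathbf{a}),(s,\mathbf{b}),(t,\mathbf{c}),(u,\mathbf{d}),(v,\mathbf{e}),(w,\mathbf{f})$ ranging over $I_{k,n}^{(1)}$.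
   Context: $K$ is an algebraically closed field of characteristic $p\geq 0$, and $k,n\geq 2$ are integers with $p\nmid k$ (no condition on $k$ when $p=0$). Fix $\lambda_1=1$ and pairwise distinct $\lambda_2,\ldots,\lambda_{n-1}\in K\setminus\{0,1\}$. The generalized Fermat curve $F_{k,n}$ of type $(k,n)$ is the smooth projective curve in $\mathbb{P}^n_K$ (homogeneous coordinates $X_0,\ldots,X_n$) defined by $$\lambda_iX_0^k+X_1^k+X_{i+1}^k=0,\qquad 1\leq i\leq n-1.$$ Set $x=X_1/X_0$ and $y_i=X_i/X_0$ for $2\leq i\leq n$. $\Omega_{F_{k,n}}$ is the canonical sheaf. For $\mathbf{a}=(a_2,\ldots,a_n)\in\mathbb{Z}^{n-1}$ write $|\mathbf{a}|=\sum_{i=2}^n a_i$. Let $$I_{k,n}^{(1)}=\left\{(r,\mathbf{a})\in\mathbb{Z}^n:\ 0\leq a_j\leq k-1\text{ for }2\leq j\leq n,\ 0\leq r\leq|\mathbf{a}|-2\right\}.$$ The differentials $\theta^{(1)}_{r,\mathbf{a}}=\dfrac{x^r dx}{y_2^{a_2}\cdots y_n^{a_n}}$, $(r,\mathbf{a})\in I_{k,n}^{(1)}$, form a $K$-basis of $V_1=H^0(F_{k,n},\Omega_{F_{k,n}})$. $S={\rm Sym}(V_1)$ is identified with the polynomial ring over $K$ in the variables $\{z_{r,\mathbf{a}}:(r,\mathbf{a})\in I_{k,n}^{(1)}\}$, with its standard grading. The graded ring $S_{F_{k,n}}=\bigoplus_{m\geq0}H^0(F_{k,n},\Omega_{F_{k,n}}^{\otimes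 m})$ has multiplication $(f\,dx^{\otimes m})(g\,dx^{\otimes m'})=fg\,dx^{\otimes(m+m')}$. For $1\leq i\leq n-1$, $\mathbf{k}(i)\in\mathbb{Z}^{n-1}$ is the vector whose $i$-th coordinate is $k$ and whose other coordinates are $0$; since $\mathbf{a}$ is indexed as $(a_2,\ldots,a_n)$, subtracting $\mathbf{k}(i)$ changes the entry $a_{i+1}$ to $a_{i+1}-k$. *)

(* Defs.v *)
(* MathComp world, with the multinomials library for multivariate polynomials. *)
From HB Require Import structures.
From mathcomp Require Import all_boot all_order all_algebra.
From mathcomp Require Import mpoly.

Set Implicit Arguments.
Unset Strict Implicit.
Unset Printing Implicit Defensive.

Import GRing.Theory.
Local Open Scope ring_scope.

(* Subsets of P^N(K) are represented by predicates on the nonzero vectors of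
   homogeneous coordinates 'I_N.+1 -> K; such vectors are compared up to a
   nonzero scalar. *)
Section ProjectiveSets.
Variable K : fieldType.

Definition proj_eq (N : nat) (P Q : 'I_N.+1 -> K) : Prop :=
  exists2 c : K, c != 0 & forall i, Q i = c * P i.

Definition zero_locus (N : nat) (E : {mpoly K[N.+1]} -> Prop)
    (P : 'I_N.+1 -> K) : Prop :=
  (exists i, P i != 0) /\ (forall g, E g -> g.@[P] = 0).

(* Compatibility of phi with scaling of the coordinates follows from the local
   description by forms of a common degree. *)
Definition proj_morphism (N M : nat) (V : ('I_N.+1 -> K) -> Prop)
    (W : ('I_M.+1 -> K) -> Prop)
    (phi : ('I_N.+1 -> K) -> ('I_M.+1 -> K)) : Prop :=
  (forall P, V P -> W (phi P)) /\
  (forall P, V P ->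
     exists (d : nat) (g : 'I_M.+1 -> {mpoly K[N.+1]}),
       [/\ forall j, g j \is d.-homog,
           exists j, (g j).@[P] != 0
         & forall Q, V Q -> (exists j, (g j).@[Q] != 0) ->
             proj_eq (phi Q) (fun j => (g j).@[Q])]).

Definition proj_isomorphic (N M : nat) (V : ('I_N.+1 -> K) -> Prop)
    (W : ('I_M.+1 -> K) -> Prop) : Prop :=
  exists phi psi,
    [/\ proj_morphism V W phi, proj_morphism W V psi,
        forall P, V P -> proj_eq (psi (phi P)) P
      & forall Q, W Q -> proj_eq (phi (psi Q)) Q].

(* Jacobian criterion; the equation G = 0 is kept next to the vanishing of the
   partial derivatives since the degree of G may be 0 in K. *)
Definition smooth_form (N : nat) (G : {mpoly K[N.+1]}) : Prop :=
  forall P : 'I_N.+1 -> K, (exists i, P i != 0) -> G.@[P] = 0 ->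
    exists i, (mderiv i G).@[P] != 0.

Definition plane_quintic (N : nat) (V : ('I_N.+1 -> K) -> Prop) : Prop :=
  exists G : {mpoly K[3]},
    [/\ G \is 5.-homog, smooth_form G
      & proj_isomorphic V (zero_locus (fun g => g = G))].

End ProjectiveSets.

Section FunctionField.
Variables (K L : fieldType) (iota : {rmorphism K -> L}).

Definition evalL (N : nat) (w : 'I_N.+1 -> L) (f : {mpoly K[N.+1]}) : L :=
  (map_mpoly iota f).@[w].

(* L is the function field of V, i.e. the degree 0 part of the homogeneous
   localization of the homogeneous coordinate ring of V, and w is the vector of
   homogeneous coordinates of the generic point (determined up to a scalar in
   L).  Since L is a field, this forces V to be irreducible. *)
Definition is_function_field (N : nat) (V : ('I_N.+1 -> K) -> Prop)
    (w : 'I_N.+1 -> L) : Prop :=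
  (forall (d : nat) (f : {mpoly K[N.+1]}), f \is d.-homog ->
     (evalL w f = 0 <-> forall P, V P -> f.@[P] = 0)) /\
  (forall u : L, exists (d : nat) (f g : {mpoly K[N.+1]}),
     [/\ f \is d.-homog, g \is d.-homog, evalL w g != 0
       & u = evalL w f / evalL w g]).

Definition local_ring (N : nat) (w : 'I_N.+1 -> L) (P : 'I_N.+1 -> K)
    (u : L) : Prop :=
  exists (d : nat) (f g : {mpoly K[N.+1]}),
    [/\ f \is d.-homog, g \is d.-homog, g.@[P] != 0
      & u = evalL w f / evalL w g].

Definition derivation (D : L -> L) : Prop :=
  [/\ forall u v, D (u + v) = D u + D v,
      forall u v, D (u * v) = D u * v + u * D v
    & forall c, D (iota c) = 0].

(* dg = h dx in the module of Kaehler differentials of L over K: the L-linear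
   forms on this L-vector space are the derivations L -> L over K, and an
   equality of vectors can be tested on linear forms. *)
Definition differential_eq (x g h : L) : Prop :=
  forall D, derivation D -> D g = h * D x.

(* The rational m-fold differential f dx^m is regular at P: it lies in the
   O_P-span of the dg_1 ... dg_m with g_1, ..., g_m in the local ring O_P, that
   is, in the stalk at P of the m-th power of the canonical sheaf of a smooth
   curve. *)
Definition regular_diff (N : nat) (w : 'I_N.+1 -> L) (x : L)
    (P : 'I_N.+1 -> K) (m : nat) (f : L) : Prop :=
  exists (q : nat) (c : 'I_q -> L) (g h : 'I_q -> 'I_m -> L),
    [/\ forall i, local_ring w P (c i),
        forall i j, local_ring w P (g i j),
        forall i j, differential_eq x (g i j) (h i j)
      & f = \sum_(i < q) c i * \prod_(j < m) h i j].

(* A finite sum of rational differentials f_m dx^m is represented by the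
   polynomial with coefficients f_m, the variable 'X standing for dx.  This
   predicate cuts out the canonical ring, whose degree m component is
   H^0(V, Omega^m), inside {poly L}. *)
Definition canonical_ring (N : nat) (V : ('I_N.+1 -> K) -> Prop)
    (w : 'I_N.+1 -> L) (x : L) (F : {poly L}) : Prop :=
  forall (m : nat) P, V P -> regular_diff w x P m F`_m.

Definition in_simple_subfield (f u : L) : Prop :=
  exists p q : {poly K},
    (map_poly iota q).[f] != 0 /\
    u = (map_poly iota p).[f] / (map_poly iota q).[f].

Definition degree_over (f : L) (d : nat) : Prop :=
  exists e : 'I_d -> L,
    (forall u, exists c : 'I_d -> L,
       (forall i, in_simple_subfield f (c i)) /\ u = \sum_(i < d) c i * e i) /\
    (forall c : 'I_d -> L, (forall i, in_simple_subfield f (c i)) ->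
       \sum_(i < d) c i * e i = 0 -> forall i, c i = 0).

(* A nonconstant morphism from a smooth projective curve to P^1 is the same as
   a nonconstant rational function f, and its degree is [L : K(f)]; a constant f
   has infinite degree. *)
Definition trigonal : Prop := exists f : L, degree_over f 3.

End FunctionField.

Section GeneralizedFermat.
Variables (k n : nat).

(* A vector (v_2, ..., v_n) is indexed from 0 by 'I_n.-1, so that the index i
   stands for the subscript i.+2 of v (and i.+1 for lambda). *)
Definition fermat_eq (K : fieldType) (lam : 'I_n.-1 -> K) (i : 'I_n.-1) :
    {mpoly K[n.+1]} :=
  lam i *: 'X_(inord 0) ^+ k + 'X_(inord 1) ^+ k + 'X_(inord i.+2) ^+ k.

Definition fermat_curve (K : fieldType) (lam : 'I_n.-1 -> K) :
    ('I_n.+1 -> K) -> Prop :=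
  zero_locus (fun g => exists i, g = fermat_eq lam i).

Definition coord_x (L : fieldType) (w : 'I_n.+1 -> L) : L :=
  w (inord 1) / w (inord 0).

Definition coord_y (L : fieldType) (w : 'I_n.+1 -> L) (j : 'I_n.-1) : L :=
  w (inord j.+2) / w (inord 0).

(* The bound on r in its type is implied by r + 2 <= |a| and only serves to make
   the set of indices a finite type. *)
Definition index1 : Type :=
  {ra : 'I_(n.-1 * k.-1) * {ffun 'I_n.-1 -> 'I_k}
   | (ra.1 + 2 <= \sum_j ra.2 j)%N}.

HB.instance Definition _ := Finite.on index1.

Definition idx_r (s : index1) : nat := (val s).1.
Definition idx_a (s : index1) (j : 'I_n.-1) : nat := (val s).2 j.

Definition theta (L : fieldType) (w : 'I_n.+1 -> L) (s : index1) : L :=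
  coord_x w ^+ idx_r s / \prod_(j < n.-1) coord_y w j ^+ idx_a s j.

Definition zvar (K : fieldType) (s : index1) : {mpoly K[#|{: index1}|]} :=
  'X_(enum_rank s).

Definition canonical_map (K L : fieldType) (iota : {rmorphism K -> L})
    (w : 'I_n.+1 -> L) (f : {mpoly K[#|{: index1}|]}) : {poly L} :=
  mmap (polyC \o iota) (fun i => theta w (enum_val i) *: 'X) f.

Definition Gbi (K : fieldType) (f : {mpoly K[#|{: index1}|]}) : Prop :=
  exists ra sb tc ud : index1,
    [/\ (idx_r ra + idx_r sb = idx_r tc + idx_r ud)%N,
        forall j, (idx_a ra j + idx_a sb j = idx_a tc j + idx_a ud j)%N
      & f = zvar K ra * zvar K sb - zvar K tc * zvar K ud].

(* The condition e + f = a + b - k(i) is written (e + f) + k(i) = a + b, since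
   subtraction is truncated on nat. *)
Definition Gtri (K : fieldType) (lam : 'I_n.-1 -> K)
    (f : {mpoly K[#|{: index1}|]}) : Prop :=
  exists (i : 'I_n.-1) (ra sb tc ud ve wf : index1),
    [/\ (idx_r tc + idx_r ud = idx_r ra + idx_r sb + k)%N /\
        (forall j, idx_a tc j + idx_a ud j = idx_a ra j + idx_a sb j)%N,
        (idx_r ve + idx_r wf = idx_r ra + idx_r sb)%N /\
        (forall j, idx_a ve j + idx_a wf j + (if j == i then k else 0) =
                   idx_a ra j + idx_a sb j)%N
      & f = lam i *: (zvar K ra * zvar K sb) + zvar K tc * zvar K ud
            + zvar K ve * zvar K wf].

End GeneralizedFermat.

Definition in_ideal_gen (R : comNzRingType) (G : R -> Prop) (f : R) : Prop :=
  exists (q : nat) (c g : 'I_q -> R),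
    (forall i, G (g i)) /\ f = \sum_(i < q) c i * g i.

(* Main.v *)
Require Import Defs.
From HB Require Import structures.
From mathcomp Require Import all_boot all_order all_algebra separable.
From mathcomp Require Import mpoly.
From mathcomp Require Import zify ring.

Set Implicit Arguments.
Unset Strict Implicit.
Unset Printing Implicit Defensive.

Import GRing.Theory.

(** The canonical sheaf of the curve is O(d) with d = (n-1)(k-1) - 2, and the
    differential theta_{r,a} corresponds to the monomial of degree d
    X_0^(|a|-2-r) X_1^r X_2^(k-1-a_2) ... X_n^(k-1-a_n); conversely each
    monomial of degree d whose exponents in X_2, ..., X_n are at most k-1 arises
    exactly once.  So a monomial of degree m in the variables z is a
    factorization of a monomial M of degree m d into m such bounded monomials,
    and the canonical map sends it to M in the homogeneous coordinate ring of
    the curve, where X_(j+1)^k = - lambda_j X_0^k - X_1^k.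

    Modulo the binomials, a monomial in z depends on M only: two factorizations
    of M are linked by exchanges that involve two factors at a time
    ([connected]).  So M has a class, [mclass].  Modulo the trinomials
    as well, the class of X_(j+1)^k M' is the combination of the classes of
    X_0^k M' and X_1^k M' that the equation of the curve prescribes
    ([fermat_rel_in]).  For a trinomial to give this, some factorization of
    X_(j+1)^k M' must have two factors whose product is divisible by
    X_(j+1)^k.  A count of degrees shows that such a factorization fails to
    exist only if k is 4 or 5 and, up to a remainder of small degree, M' is
    filled up by the variables X_i with i >= 2, i <> j+1.  If n >= 3, some other
    X_(i+1)^k can then be replaced first, and the relation follows by replacing
    the two powers in either order.  If n = 2 there is no other variable: the
    exceptions are the plane quartic, which is trigonal by projection from one
    of its points, and the plane quintic.

    By these relations each element of degree m is congruent to a combination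
    of classes of monomials with exponents less than k in X_2, ..., X_n
    ([all_normalizable]).  On the curve those monomials are linearly independent
    ([monomials_free]): above a general value of x, the points of the curve
    form a grid with k values of each y_j, and a polynomial of degree less than
    k in each y_j that vanishes on the grid is zero.  Hence an element of the
    kernel has the zero normal form.

    Regularity of the differentials is local: at each point of the curve one of
    x, 1/x, y_j has a differential that divides all the theta_{r,a} in the local
    ring ([local_generator]). *)

(** * Factorizations into monomials with bounded exponents *)

Section VeroneseType.
Variables (I : finType) (T : eqType) (e : T -> I -> nat) (c : I -> nat) (d : nat).
Hypothesis e_sum : forall t, \sum_i e t i = d.
Hypothesis e_le : forall t i, e t i <= c i.
Hypothesis e_surj : forall u : I -> nat,
  \sum_i u i = d -> (forall i, u i <= c i) -> exists t, e t =1 u.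
Hypothesis e_inj : forall t t', e t =1 e t' -> t = t'.

Definition weight (s : seq T) (i : I) : nat := \sum_(t <- s) e t i.

(** Exponent vectors of the monomials that a product of [m] bounded monomials of
    degree [d] can be. *)
Definition admissible (m : nat) (M : I -> nat) : Prop :=
  \sum_i M i = m * d /\ forall i, M i <= m * c i.

Lemma weight_cons a s i : weight (a :: s) i = e a i + weight s i.
Proof. exact: big_cons. Qed.

Lemma weight_perm s t : perm_eq s t -> weight s =1 weight t.
Proof. by move=> st i; apply: perm_big. Qed.

Lemma weight_admissible s : admissible (size s) (weight s).
Proof.
split=> [|i]; rewrite /weight.
  rewrite exchange_big /= (eq_bigr (fun=> d)) => [|t _]; last exact: e_sum.
  by rewrite big_const_seq count_predT iter_addn_0 mulnC.
elim: s => [|a s IHs]; first by rewrite big_nil.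
by rewrite big_cons /= mulSn leq_add.
Qed.

Lemma sum_between (L U : I -> nat) D :
    (forall i, L i <= U i) -> \sum_i L i <= D -> D <= \sum_i U i ->
  exists u : I -> nat, (forall i, L i <= u i <= U i) /\ \sum_i u i = D.
Proof.
move=> LU; move En: (D - \sum_i L i) => q.
elim: q L LU En => [|q IHq] L LU En LD DU.
  by exists L; split=> [i|]; [rewrite leqnn LU | lia].
have [i ltLU] : exists i, L i < U i.
  apply/existsP; apply: contraT; rewrite negb_exists => /forallP UL.
  have: \sum_i U i <= \sum_i L i by apply: leq_sum => i _; have := UL i; lia.
  lia.
have sumL : \sum_j (L j + (j == i)) = (\sum_j L j).+1.
  by rewrite big_split /= -big_mkcond /= big_pred1_eq addn1.
have [||||u [Lu su]] := IHq (fun j => L j + (j == i)); rewrite ?sumL; try lia.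
  by move=> j; case: eqP => [->|_]; rewrite ?addn0 ?addn1.
by exists u; split=> // j; have := Lu j; lia.
Qed.

(** A first factor [u] must satisfy M - (m-1) c <= u <= min(M, c), so that the
    quotient is again admissible.  The uniform vector M/m lies between these
    bounds and has degree d, hence an integral vector of degree d does too. *)
Lemma factorization m M : admissible m M ->
  exists s, size s = m /\ weight s =1 M.
Proof.
elim: m M => [|m IHm] M [sM leM].
  exists [::]; split=> // i; rewrite /weight big_nil.
  by apply/esym/eqP; rewrite -leqn0; have := leM i.
have [|||u [Lu su]] := @sum_between (fun i => M i - m * c i)
    (fun i => minn (M i) (c i)) d.
- by move=> i; have := leM i; lia.
- rewrite -(leq_pmul2l (ltn0Sn m)) -sM big_distrr /=.
  by apply: leq_sum => i _; have := leM i; nia.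
- rewrite -(leq_pmul2l (ltn0Sn m)) -sM big_distrr /=.
  by apply: leq_sum => i _; have := leM i; nia.
have [|t et] := e_surj su; first by move=> i; have := Lu i; lia.
have [|s [sz ws]] := IHm (fun i => M i - u i).
  split=> [|i]; last by have := Lu i; lia.
  have : \sum_i (M i - u i) + \sum_i u i = \sum_i M i.
    by rewrite -big_split /=; apply: eq_bigr => i _; have := Lu i; lia.
  by rewrite su sM mulSn; lia.
exists (t :: s); split=> [|i]; first by rewrite /= sz.
by rewrite weight_cons et ws; have := Lu i; lia.
Qed.

Lemma exchange a b i j : i != j -> 0 < e a i -> e a j < c j ->
    0 < e b j -> e b i < c i ->
  exists a' b', (forall l, e a' l + (l == i) = e a l + (l == j)) /\
                (forall l, e b' l + (l == j) = e b l + (l == i)).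
Proof.
have one (x : T) (p q : I) : p != q -> 0 < e x p -> e x q < c q ->
    exists x', forall l, e x' l + (l == p) = e x l + (l == q).
  move=> pq xp xq.
  have xE l : (e x l + (l == q) - (l == p)) + (l == p) = e x l + (l == q).
    by case: (l =P p) => [->|_] /=; lia.
  have [||x' x'E] := e_surj (u := fun l => e x l + (l == q) - (l == p)).
  - have : \sum_l (e x l + (l == q) - (l == p)) + \sum_l (l == p : nat)
           = \sum_l e x l + \sum_l (l == q : nat).
      by rewrite -!big_split /=; apply: eq_bigr.
    have delta r : \sum_l (l == r : nat) = 1.
      by rewrite -big_mkcond /= big_pred1_eq.
    by rewrite !delta e_sum; lia.
  - move=> l; have := e_le x l; case: (l =P q) => [->|_] /=; lia.
  by exists x' => l; rewrite x'E xE.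
move=> ij ai aj bj bi.
have [a' a'E] := one a i j ij ai aj.
have [|b' b'E] := one b j i _ bj bi; first by rewrite eq_sym.
by exists a', b'.
Qed.

(** [R] stands for congruence modulo the binomials: it is enough that two factors
    with the same product may be replaced. *)
Section Connected.
Variable R : seq T -> seq T -> Prop.
Hypothesis R_perm : forall s t, perm_eq s t -> R s t.
Hypothesis R_trans : forall s t u, R s t -> R t u -> R s u.
Hypothesis R_cons : forall a s t, R s t -> R (a :: s) (a :: t).
Hypothesis R_swap : forall a b a' b' s,
  (forall i, e a i + e b i = e a' i + e b' i) -> R [:: a, b & s] [:: a', b' & s].

Let lt_sum_ex (f g : I -> nat) :
  \sum_i f i = \sum_i g i -> forall i, f i < g i -> exists j, g j < f j.
Proof.
move=> fg i fi; apply/existsP; apply: contraT; rewrite negb_exists => /forallP le.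
have: \sum_j f j < \sum_j g j.
  rewrite (bigD1 i) //= [X in _ < X](bigD1 i) //= -addSn leq_add //.
  by apply: leq_sum => j _; have := le j; lia.
by rewrite fg ltnn.
Qed.

(** To bring [u] closer to [v] one wants to trade [i] against [j] with another
    factor [w], which must contain [j] and have room for [i].  Each of the two
    conditions is met by some factor; if not by the same one, then a trade of
    [i] between two factors other than [u] makes them meet. *)
Lemma exchange_partner i j s u v t : size s = size t -> i != j ->
    weight (u :: s) =1 weight (v :: t) -> e v i < e u i -> e u j < e v j ->
  exists w s', [/\ R (u :: s) [:: u, w & s'], size s = (size s').+1,
    weight s =1 weight (w :: s'), 0 < e w j & e w i < c i].
Proof.
move=> sz ij wE ui uj.
(* The remaining factors of the two products compare at [j] and at [i] in the
   sense opposite to [u] and [v]. *)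
have [w ws wj] : exists2 w, w \in s & 0 < e w j.
  apply/hasP; rewrite -[has _ _]negbK -all_predC; apply/negP => /allP s0.
  have := wE j; rewrite !weight_cons {1}/weight big1_seq; first by lia.
  by move=> x /= /s0 /=; lia.
have [w2 w2s w2i] : exists2 w, w \in s & e w i < c i.
  apply/hasP; rewrite -[has _ _]negbK -all_predC; apply/negP => /allP s0.
  have := wE i; rewrite !weight_cons.
  have -> : weight s i = size s * c i.
    rewrite /weight (eq_big_seq (fun=> c i)) => [|x /s0 /=].
      by rewrite big_const_seq count_predT iter_addn_0 mulnC.
    by have := e_le x i; lia.
  by have [_ /(_ i)] := weight_admissible t; rewrite sz; lia.
have simple x : x \in s -> 0 < e x j -> e x i < c i ->
  exists w s', [/\ R (u :: s) [:: u, w & s'], size s = (size s').+1,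
    weight s =1 weight (w :: s'), 0 < e w j & e w i < c i].
  move=> xs xj xi; have px := perm_to_rem xs.
  exists x, (rem x s); split=> //; first exact/R_cons/R_perm.
    exact: perm_size px.
  exact: weight_perm.
have [wi|wi] := ltnP (e w i) (c i); first exact: (simple w).
have {}wi : e w i = c i by have := e_le w i; lia.
have [w2j|w2j] := posnP (e w2 j); last exact: (simple w2).
have [l w2l] : exists l, e w l < e w2 l.
  by apply: (@lt_sum_ex _ _ _ i); rewrite ?e_sum ?wi.
have il : i != l by apply: contraL w2l => /eqP <-; rewrite wi -leqNgt e_le.
have lj : l != j by apply: contraL w2l => /eqP ->; rewrite w2j.
have [|||||w' [w2' [w'E w2'E]]] := @exchange w w2 i l; try lia.
  by have := e_le w2 l; lia.
have w2s' : w2 \in rem w s.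
  have := w2s; rewrite (perm_mem (perm_to_rem ws)) inE.
  by case/orP=> // /eqP ww; rewrite ww wi ltnn in w2i.
have px : perm_eq s [:: w, w2 & rem w2 (rem w s)].
  by rewrite (permPl (perm_to_rem ws)) perm_cons perm_to_rem.
(* [w] keeps its factor [j]: the index [l] received in exchange is not [j],
   which is absent from [w2]. *)
have sumE x : e w x + e w2 x = e w' x + e w2' x.
  by have := w'E x; have := w2'E x; lia.
exists w', (w2' :: rem w2 (rem w s)); split.
- apply/R_cons/(R_trans (R_perm px)); exact: R_swap.
- exact: (perm_size px).
- by move=> x; rewrite (weight_perm px) !weight_cons !addnA sumE.
- have := w'E j; rewrite (eq_sym j l) (negbTE lj) (eq_sym j i) (negbTE ij); lia.
- have := w'E i; rewrite eqxx (negbTE il); lia.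
Qed.

(** The first factor of [s] is changed into that of [t] by exchanges, each of
    which decreases the distance between them; the remaining factors are
    handled by induction. *)
Lemma connected s t : size s = size t -> weight s =1 weight t -> R s t.
Proof.
elim: t s => [|v t IHt] [|u s] //= => [_ _|[sz] wE]; first exact: R_perm.
move Dn: (\sum_i (e u i - e v i)) => q.
elim/ltn_ind: q u s Dn sz wE => q IHq u s Dn sz wE.
have [le_uv|[i vui]] : (forall i, e u i <= e v i) \/ exists i, e v i < e u i.
  have [/forallP|] := boolP [forall i, e u i <= e v i]; first by left.
  by rewrite negb_forall => /existsP[i]; rewrite -ltnNge; right; exists i.
  have uv : e u =1 e v.
    move=> i; apply/eqP; rewrite eqn_leq le_uv leqNgt; apply/negP => ltuv.
    have [||j] := @lt_sum_ex (e u) (e v) _ i; rewrite ?e_sum //.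
    by rewrite ltnNge le_uv.
  rewrite (e_inj uv); apply/R_cons/IHt => // i.
  by have := wE i; rewrite !weight_cons uv => /addnI.
have [||j uvj] := @lt_sum_ex (e v) (e u) _ i; rewrite ?e_sum //.
have ij : i != j by apply: contraL uvj => /eqP <-; rewrite -leqNgt ltnW.
have [w [s' [Rs sz' ws wj wi]]] := exchange_partner sz ij wE vui uvj.
have [||||u' [w' [u'E w'E]]] := @exchange u w i j ij; try lia.
  by have := e_le v j; lia.
have sumE x : e u x + e w x = e u' x + e w' x.
  by have := w'E x; have := u'E x; lia.
apply: R_trans Rs _; apply: R_trans (R_swap _ sumE) _.
have iP := u'E i; have jP := u'E j.
rewrite eqxx (negbTE ij) eq_sym (negbTE ij) eqxx in iP jP.
apply: (IHq _ _ u' (w' :: s') erefl) => [||x]; last 1 first.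
- by rewrite -wE !weight_cons addnA -sumE -addnA ws weight_cons.
- rewrite -Dn (bigD1 i) //= [X in _ < X](bigD1 i) //=.
  rewrite -addSn leq_add //; first by lia.
  apply: leq_sum => l li; have := u'E l; rewrite (negbTE li).
  by case: (l =P j) => [->|_] /=; lia.
- by rewrite /= -sz'.
Qed.

End Connected.
End VeroneseType.

(** * Splitting off two factors whose product is divisible by a k-th power *)

(** Exponents are indexed by [inl false] for X_0, [inl true] for X_1 and [inr j]
    for the variable X_(j+2); [K] is k-1 and [N] is n-1. *)
Section Degrees.
Variables (N K d : nat).
Hypothesis dE : d + 2 = N * K.
Hypothesis d_gt0 : 0 < d.

Definition cap (i : bool + 'I_N) : nat := if i is inr _ then K else d.

(** The part of the exponent that m-2 factors cannot absorb, hence must appear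
    in the two remaining factors. *)
Definition excess m (M : bool + 'I_N -> nat) (i : 'I_N) : nat :=
  M (inr i) - (m - 2) * K.

(** Either the two split factors are forced to contain the k-th power, or the
    degree 2d leaves room for it next to what is forced. *)
Definition reducible m (M : bool + 'I_N -> nat) (j : 'I_N) : bool :=
  (K < excess m M j) || (K.+1 + \sum_(i | i != j) excess m M i <= 2 * d).

Lemma sum_split (M : bool + 'I_N -> nat) :
  \sum_i M i = M (inl true) + M (inl false) + \sum_j M (inr j).
Proof. by rewrite big_sumType /= big_bool. Qed.

Lemma K_gt0 : 0 < K. Proof. by have := dE; case: K => [|//]; lia. Qed.

(** The split part must lie between its forced part, raised to k at [j], and the
    maximal exponents; [reducible] ensures that the lower bound has degree at
    most 2d. *)
Lemma extract_quadric m M j : admissible cap d m M -> 1 < m ->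
    K < M (inr j) -> reducible m M j ->
  exists P Q : bool + 'I_N -> nat, [/\ admissible cap d 2 P, admissible cap d (m - 2) Q,
    forall i, M i = P i + Q i & K < P (inr j)].
Proof.
move=> [sM leM] m2 Mj red; have K0 := K_gt0.
have xle i : excess m M i <= 2 * K by have /= := leM (inr i); rewrite /excess; nia.
have xM i : m * excess m M i <= 2 * M (inr i).
  by have /= := leM (inr i); rewrite /excess; nia.
pose L (i : bool + 'I_N) :=
  if i is inr l then if l == j then maxn K.+1 (excess m M j) else excess m M l else 0.
have [|||P [LP' sP]] := @sum_between _ L (fun i => minn (M i) (2 * cap i)) (2 * d).
- move=> [b|l] //=; have := xle l; have := leq_subr ((m - 2) * K) (M (inr l)).
  rewrite -/(excess m M l); case: (l =P j) => [->|_] xM' xl; rewrite leq_min ?geq_max.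
    by apply/andP; split; apply/andP; split=> //; lia.
  by apply/andP.
- rewrite sum_split /= !add0n (bigD1 j) //= eqxx.
  rewrite (eq_bigr (excess m M)) => [|l /negbTE -> //].
  have [xj|xj] := ltnP K (excess m M j); last first.
    by move: red; rewrite /reducible ltnNge xj (maxn_idPl (leqW xj)).
  rewrite (maxn_idPr xj).
  have -> : excess m M j + \sum_(l | l != j) excess m M l = \sum_l excess m M l.
    by rewrite [RHS](bigD1 j).
  rewrite -(leq_pmul2l (ltnW m2)) big_distrr /=.
  apply: (@leq_trans (\sum_l 2 * M (inr l))); first by apply: leq_sum.
  by rewrite -big_distrr /= mulnCA -sM sum_split leq_mul2l leq_addl orbT.
- rewrite -(leq_pmul2l (ltnW m2)) mulnCA -sM !big_distrr /=.
  by apply: leq_sum => i _; have := leM i; nia.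
have LP (i : bool + 'I_N) : L i <= P i <= minn (M i) (2 * cap i) := LP' i.
have sQ : \sum_i (M i - P i) = (m - 2) * d.
  have : \sum_i (M i - P i) + \sum_i P i = \sum_i M i.
    by rewrite -big_split /=; apply: eq_bigr => i _; have := LP i; lia.
  by rewrite sP sM mulnBl; lia.
exists P, (fun i => M i - P i); split.
- by split=> // i; have := LP i; lia.
- split=> // -[b|l] /=; last by have := LP (inr l); rewrite /L /excess /=; case: eqP => [->|_]; lia.
  by rewrite -sQ (bigD1 (inl b)) //= leq_addr.
- by move=> i; have := LP i; lia.
- by have := LP (inr j); rewrite /L eqxx; lia.
Qed.

(** If M is not reducible at [j], then nearly all the other variables are
    saturated, which a comparison of degrees allows for k = 4 and k = 5 only.
    Then one of them, [i], contributes at least k to the forced part, so that M is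
    reducible at [i]; lowering that exponent by k makes room for [j]. *)
Lemma reducible_or m M j : admissible cap d m M -> 1 < m -> K < M (inr j) ->
    (N = 1 -> 4 < K) ->
  reducible m M j \/ exists i : 'I_N, [/\ i != j, K < excess m M i &
    forall M' : bool + 'I_N -> nat, M' (inr i) + K.+1 = M (inr i) ->
      (forall l : 'I_N, l != i -> M' (inr l) = M (inr l)) -> reducible m M' j].
Proof.
move=> [sM leM] m2 Mj N1; have K0 := K_gt0.
have xle i : excess m M i <= 2 * K by have /= := leM (inr i); rewrite /excess; nia.
have [red|nred] := boolP (reducible m M j); [by left | right].
move: nred; rewrite negb_or -leqNgt -ltnNge => /andP[xj Sgt].
(* [A] is the set of the other variables with a forced part, for which the
   excess is a true difference and can be summed. *)
pose A := [pred i | (i != j) && (0 < excess m M i)].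
have cA : #|A| < N.
  rewrite -[X in _ < X]card_ord; apply: proper_card; apply/properP; split.
    exact/subsetP.
  by exists j => //; rewrite inE eqxx.
have N_gt0 : 0 < N by apply: leq_ltn_trans cA.
have SA : \sum_(i | i != j) excess m M i = \sum_(i in A) excess m M i.
  rewrite [LHS](bigID (fun i => 0 < excess m M i)) /= [X in _ + X]big1 ?addn0 //.
  by move=> i /andP[_]; rewrite lt0n negbK => /eqP.
have S2 : \sum_(i | i != j) excess m M i <= #|A| * (2 * K).
  by rewrite SA -sum_nat_const; apply: leq_sum => i _; apply: xle.
have S1 : \sum_(i | i != j) excess m M i + #|A| * ((m - 2) * K) + K.+1 <= m * d.
  rewrite SA -sum_nat_const -big_split /= -sM sum_split.
  rewrite [X in _ <= _ + X](bigD1 j) //= [X in _ <= _ + X](addnC (M (inr j))) addnA.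
  apply: leq_add => //; apply: leq_trans (leq_addl _ _).
  rewrite [X in _ <= X](bigID (fun i => 0 < excess m M i)) /=.
  apply: leq_trans (leq_addr _ _); apply: leq_sum => i /andP[_]; rewrite /excess; lia.
set S := \sum_(_ | _) _ in Sgt S1 S2 SA *; set a := #|A| in cA S1 S2 *.
(* If #|A| K >= d, the bound [S1] alone gives the inequality; otherwise the bound
   [S2] does, unless every other variable lies in [A] and K is 3 or 4. *)
have bad : 1 < N /\ (K == 3) || (K == 4).
  have aK : a * K < d by rewrite ltnNge; apply/negP => aK; nia.
  have [aN|aN] : a = N - 1 \/ a <= N - 2 by lia.
    have aKE : a * K + K = d + 2 by rewrite dE aN; nia.
    have [N1'|] : N = 1 \/ 1 < N by lia.
      by have := N1 N1'; move: dE; rewrite N1' mul1n; nia.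
    move=> N2; split => //; nia.
  have aKE : a * K + 2 * K <= d + 2 by rewrite dE; nia.
  by exfalso; nia.
have [N2 K34] := bad.
have [i /andP[ij xi]] : exists i : 'I_N, (i != j) && (K < excess m M i).
  apply/existsP; apply: contraT; rewrite negb_exists => /forallP xK.
  have : S <= (N - 1) * K.
    apply: (@leq_trans (\sum_(l | l != j) K)).
      by apply: leq_sum => i ij; have := xK i; rewrite ij -leqNgt.
    by rewrite sum_nat_const (eq_card (B := predC1 j)) // cardC1 card_ord subn1.
  have NK : (N - 1) * K + K = d + 2 by rewrite dE mulnBl; nia.
  have : N * K >= 2 * K by rewrite leq_mul2r N2 orbT.
  by case/orP: K34 => /eqP K34; lia.
exists i; split=> // M' M'i M'l; apply/orP; right.
have : K.+1 + \sum_(l | l != j) excess m M' l = S.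
  rewrite /S (bigD1 i) //= [RHS](bigD1 i) //= addnA; congr (_ + _).
    by move: xi; rewrite /excess -M'i; move: ((m - 2) * K) => y; lia.
  by apply: eq_bigr => l /andP[_ li]; rewrite /excess M'l.
have aK : a * K + K <= d + 2 by rewrite dE; nia.
have : a * (2 * K) = 2 * (a * K) by lia.
by case/orP: K34 => /eqP K34; lia.
Qed.

End Degrees.

Local Open Scope ring_scope.

(** * Ideals given by generators *)

Section Ideal.
Variables (R : comNzRingType) (G : R -> Prop).
Local Notation J := (in_ideal_gen G).

Lemma ideal0 : J 0.
Proof.
by exists 0%N, (fun=> 0), (fun=> 0); split; [case | rewrite big_ord0].
Qed.

Lemma idealD f g : J f -> J g -> J (f + g).
Proof.
move=> [p [a [x [Gx ->]]]] [q [b [y [Gy ->]]]].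
exists (p + q)%N, (fun i => match split i with inl i => a i | inr i => b i end),
  (fun i => match split i with inl i => x i | inr i => y i end).
split=> [i|]; first by case: (split i).
rewrite big_split_ord /=; congr (_ + _); apply: eq_bigr => i _.
  by rewrite (unsplitK (inl i)).
by rewrite (unsplitK (inr i)).
Qed.

Lemma idealM h f : J f -> J (h * f).
Proof.
move=> [p [a [x [Gx ->]]]]; exists p, (fun i => h * a i), x; split=> //.
by rewrite big_distrr /=; apply: eq_bigr => i _; rewrite mulrA.
Qed.

Lemma idealN f : J f -> J (- f).
Proof. by rewrite -mulN1r; apply: idealM. Qed.

Lemma idealB f g : J f -> J g -> J (f - g).
Proof. by move=> Jf /idealN; apply: idealD. Qed.

Lemma ideal_gen g : G g -> J g.
Proof.
by move=> Gg; exists 1%N, (fun=> 1), (fun=> g); rewrite big_ord1 mul1r.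
Qed.

End Ideal.

(** * Canonical differentials as bounded monomials *)

Section Exponents.
Variables k n : nat.
Hypothesis genus : (2 < n.-1 * k.-1)%N.

Definition canon_deg : nat := (n.-1 * k.-1 - 2)%N.
Local Notation d := canon_deg.

Lemma canon_degE : (d + 2 = n.-1 * k.-1)%N.
Proof. by rewrite /canon_deg; lia. Qed.

Lemma canon_deg_gt0 : (0 < d)%N.
Proof. by rewrite /canon_deg; lia. Qed.

Hypothesis k2 : (2 <= k)%N.

(** The exponents of X_0, X_1 and X_(j+2) in the monomial that corresponds to
    theta_{r,a}; the condition r + 2 <= |a| makes the exponent of X_0 a true
    difference. *)
Definition exponent (s : index1 k n) (i : bool + 'I_n.-1) : nat :=
  match i with
  | inl true => idx_r s
  | inl false => (\sum_j idx_a s j - 2 - idx_r s)%N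
  | inr j => (k.-1 - idx_a s j)%N
  end.

Lemma idx_a_lt (s : index1 k n) j : (idx_a s j < k)%N.
Proof. exact: ltn_ord. Qed.

Lemma idx_r_le (s : index1 k n) : (idx_r s + 2 <= \sum_j idx_a s j)%N.
Proof. exact: (valP s). Qed.

Lemma sum_compl (a : 'I_n.-1 -> nat) : (forall j, a j < k)%N ->
  (\sum_j (k.-1 - a j) + \sum_j a j = d + 2)%N.
Proof.
move=> ak; rewrite -big_split /= canon_degE.
rewrite (eq_bigr (fun=> k.-1)) => [|j _]; last by have := ak j; lia.
by rewrite sum_nat_const card_ord.
Qed.

Lemma exponent_sum s : (\sum_i exponent s i = d)%N.
Proof.
rewrite sum_split /=; have := sum_compl (idx_a_lt s); have := idx_r_le s.
set A := (\sum_j idx_a s j)%N; set B := (\sum_j (_ - _))%N; lia.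
Qed.

Lemma exponent_le s i : (exponent s i <= cap k.-1 d i)%N.
Proof.
case: i => [b|j] /=; last exact: leq_subr.
by rewrite -(exponent_sum s) (bigD1 (inl b)) //= leq_addr.
Qed.

Lemma exponent_surj (u : bool + 'I_n.-1 -> nat) : (\sum_i u i = d)%N ->
  (forall i, u i <= cap k.-1 d i)%N -> exists s, exponent s =1 u.
Proof.
rewrite sum_split => su leu.
have uk j : (u (inr j) <= k.-1)%N by exact: (leu (inr j)).
have rP : (u (inl true) < n.-1 * k.-1)%N.
  by have := canon_degE; have := leu (inl true); rewrite /=; lia.
have aP j : (k.-1 - u (inr j) < k)%N by lia.
have sa : (\sum_j (k.-1 - u (inr j)) = u (inl true) + u (inl false) + 2)%N.
  have uk' j : (u (inr j) < k)%N by have := uk j; lia.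
  have := sum_compl uk'; rewrite -su; set a := (\sum_j _)%N; set b := (\sum_j _)%N.
  by rewrite -/b; lia.
pose a : {ffun 'I_n.-1 -> 'I_k} := [ffun j => Ordinal (aP j)].
have sP : ((Ordinal rP, a).1 + 2 <= \sum_j (Ordinal rP, a).2 j)%N.
  rewrite (eq_bigr (fun j => k.-1 - u (inr j))%N) => [|j _]; last by rewrite ffunE.
  by rewrite sa /=; lia.
exists (exist (fun ra : 'I_(n.-1 * k.-1) * {ffun 'I_n.-1 -> 'I_k} =>
  (ra.1 + 2 <= \sum_j ra.2 j)%N) (Ordinal rP, a) sP) => -[[]|j] /=; rewrite /idx_r /idx_a //=.
  rewrite (eq_bigr (fun j => k.-1 - u (inr j))%N) => [|j _]; last by rewrite ffunE.
  by rewrite sa; lia.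
by rewrite ffunE /=; have := uk j; lia.
Qed.

Lemma exponent_a s j : idx_a s j = (k.-1 - exponent s (inr j))%N.
Proof. by have := idx_a_lt s j; rewrite /=; lia. Qed.

Lemma exponent_inj s t : exponent s =1 exponent t -> s = t.
Proof.
move=> st; apply/val_inj.
have rE : (val s).1 = (val t).1 by apply/val_inj; exact: (st (inl true)).
have aE : (val s).2 = (val t).2.
  apply/ffunP => j; apply/val_inj.
  by have := exponent_a s j; rewrite st -exponent_a.
by move: rE aE; case: (val s) => ? ?; case: (val t) => ? ? /= -> ->.
Qed.

End Exponents.

(** * Normal forms modulo the quadrics *)

Section Reduction.
Variables (F : fieldType) (k n : nat) (lam : 'I_n.-1 -> F).
Hypothesis k2 : (2 <= k)%N.
Hypothesis genus : (2 < n.-1 * k.-1)%N.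

Local Notation d := (canon_deg k n).
Local Notation T := (index1 k n).
Local Notation S := {mpoly F[#|{: T}|]}.
Local Notation adm := (admissible (cap k.-1 d) d).
Local Notation wt := (weight (@exponent k n)).

Definition quadric_ideal (f : S) : Prop :=
  in_ideal_gen (fun g => Gbi g \/ Gtri lam g) f.
Local Notation J := quadric_ideal.

Definition zmon (s : seq T) : S := \prod_(t <- s) zvar F t.

Lemma zmon_cons a s : zmon (a :: s) = zvar F a * zmon s.
Proof. exact: big_cons. Qed.

Lemma quadric0 : J 0. Proof. exact: ideal0. Qed.
Lemma quadricD f g : J f -> J g -> J (f + g). Proof. exact: idealD. Qed.
Lemma quadricM h f : J f -> J (h * f). Proof. exact: idealM. Qed.
Lemma quadricB f g : J f -> J g -> J (f - g). Proof. exact: idealB. Qed.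
Lemma quadricZ c f : J f -> J (c *: f).
Proof. by rewrite -mul_mpolyC; apply: quadricM. Qed.

(** An exchange between two factors is a binomial relation. *)
Lemma zmon_congr s t : size s = size t -> wt s =1 wt t -> J (zmon s - zmon t).
Proof.
apply: (@connected _ _ (@exponent k n) (cap k.-1 d) d _ _ _ _
  (fun s t => J (zmon s - zmon t))) => //.
- exact: exponent_sum.
- exact: exponent_le.
- exact: exponent_surj.
- exact: exponent_inj.
- by move=> {}s {}t st; rewrite /zmon (perm_big _ st) subrr; apply: quadric0.
- by move=> {}s {}t u Jst Jtu; rewrite -(subrKA (zmon t)); apply: quadricD.
- by move=> a {}s {}t Jst; rewrite !zmon_cons -mulrBr; apply: quadricM.
- move=> a b a' b' {}s ab.
  rewrite !zmon_cons !mulrA -mulrBl mulrC; apply/quadricM/ideal_gen; left.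
  exists a, b, a', b'; split=> //; first exact: (ab (inl true)).
  move=> j; have := ab (inr j) => /=.
  have := idx_a_lt a j; have := idx_a_lt b j.
  have := idx_a_lt a' j; have := idx_a_lt b' j; lia.
Qed.

(** The product of the variables over some factorization of [M]; by [zmon_congr]
    the choice does not matter modulo the ideal. *)
Definition mclass (m : nat) (M : bool + 'I_n.-1 -> nat) : S :=
  if [pick s : m.-tuple T | [forall i, wt s i == M i]] is Some s
  then zmon s else 0.

Lemma eq_mclass m M M' : M =1 M' -> mclass m M = mclass m M'.
Proof.
move=> MM'; rewrite /mclass; congr (if _ is Some s then _ else _).
by apply: eq_pick => s; apply: eq_forallb => i; rewrite MM'.
Qed.

Lemma zmon_mclass s M : wt s =1 M -> J (zmon s - mclass (size s) M).
Proof.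
move=> sM; rewrite /mclass; case: pickP => [t /forallP tM|/(_ (in_tuple s))].
  by apply: zmon_congr => [|i]; rewrite ?size_tuple // sM (eqP (tM i)).
by case/negP; apply/forallP => i; rewrite sM.
Qed.

Lemma admissible_zmon m M : adm m M ->
  exists s, [/\ size s = m, wt s =1 M & J (zmon s - mclass m M)].
Proof.
move=> admM.
have [s [sz sM]] := factorization (exponent_surj genus k2) admM.
by exists s; split=> //; rewrite -sz; apply: zmon_mclass.
Qed.

Lemma mclass_mul m p P Q M : adm m P -> adm p Q -> (forall i, M i = P i + Q i)%N ->
  J (mclass (m + p) M - mclass m P * mclass p Q).
Proof.
move=> /admissible_zmon[s [sz sP Js]] /admissible_zmon[t [sz' tQ Jt]] ME.
have stM : wt (s ++ t) =1 M.
  by move=> i; rewrite /weight big_cat /= -/(wt _ _) -/(wt _ _) sP tQ ME.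
have := zmon_mclass stM; rewrite size_cat sz sz' => Jst.
have -> : mclass (m + p) M - mclass m P * mclass p Q =
  mclass m P * (zmon t - mclass p Q) + zmon t * (zmon s - mclass m P)
  - (zmon (s ++ t) - mclass (m + p) M).
  by rewrite /zmon big_cat /=; ring.
by apply: quadricB => //; apply: quadricD; apply: quadricM.
Qed.

(** Multiplication of the monomial [M] by the [k]-th power of a variable. *)
Definition addk (M : bool + 'I_n.-1 -> nat) (i l : bool + 'I_n.-1) : nat :=
  (M l + k * (l == i))%N.

Definition subk (M : bool + 'I_n.-1 -> nat) (i l : bool + 'I_n.-1) : nat :=
  (M l - k * (l == i))%N.

Lemma subkK M i : (k <= M i)%N -> M =1 addk (subk M i) i.
Proof.
move=> kM l; rewrite /addk /subk; case: (l =P i) => [->|_].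
  by rewrite muln1 subnK.
by rewrite muln0 subn0 addn0.
Qed.

Lemma sum_addk M i : (\sum_l addk M i l = \sum_l M l + k)%N.
Proof.
rewrite big_split /= -big_distrr /= -[in RHS](muln1 k); congr (_ + _ * _)%N.
by rewrite -big_mkcond /= big_pred1_eq.
Qed.

(** X_0 and X_1 are bounded by the total degree only, so a k-th power may always be
    moved to them. *)
Lemma addk_admissible m M i b : adm m (addk M i) -> adm m (addk M (inl b)).
Proof.
move=> [sM leM]; have sb : (\sum_l addk M (inl b) l = m * d)%N by rewrite -sM !sum_addk.
split=> // -[b'|j]; first by rewrite -sb (bigD1 (inl b')) //= leq_addr.
by have := leM (inr j); rewrite /addk /= muln0 addn0; apply: leq_trans; apply: leq_addr.
Qed.

(** In degree 2 the relation is one of the trinomials, once factorizations of the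
    three monomials are chosen. *)
Lemma fermat_rel_deg2 M j : adm 2 (addk M (inr j)) ->
  J (lam j *: mclass 2 (addk M (inl false)) + mclass 2 (addk M (inl true))
     + mclass 2 (addk M (inr j))).
Proof.
move=> admM.
have [[|x [|x' [|? ?]]] [] // _ s0 J0] := admissible_zmon (addk_admissible false admM).
have [[|y [|y' [|? ?]]] [] // _ s1 J1] := admissible_zmon (addk_admissible true admM).
have [[|z [|z' [|? ?]]] [] // _ s2 J2] := admissible_zmon admM.
set c0 := mclass _ _ in J0 *; set c1 := mclass _ _ in J1 *; set c2 := mclass _ _ in J2 *.
have J3 : J (lam j *: zmon [:: x; x'] + zmon [:: y; y'] + zmon [:: z; z']).
  apply: ideal_gen; right; exists j, x, x', y, y', z, z'.
  have E s0' s1' i : wt [:: s0'; s1'] i = (exponent s0' i + exponent s1' i)%N.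
    by rewrite /weight !big_cons big_nil addn0.
  split; last by rewrite !zmon_cons /zmon big_nil !mulr1.
    split=> [|l].
      have := s0 (inl true); have := s1 (inl true).
      by rewrite !E /addk /= muln0 muln1 => -> ->; rewrite addn0.
    have := s0 (inr l); have := s1 (inr l); rewrite !E /addk /= !muln0.
    have := idx_a_lt x l; have := idx_a_lt x' l.
    have := idx_a_lt y l; have := idx_a_lt y' l; lia.
  split=> [|l].
    have := s0 (inl true); have := s2 (inl true).
    by rewrite !E /addk /= !muln0 => -> ->.
  have := s0 (inr l); have := s2 (inr l); rewrite !E /addk /= muln0.
  rewrite -[inr l == inr j]/(l == j).
  have := idx_a_lt x l; have := idx_a_lt x' l.
  by have := idx_a_lt z l; have := idx_a_lt z' l; case: (l == j) => /=; lia.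
have -> : lam j *: c0 + c1 + c2 =
  (lam j *: zmon [:: x; x'] + zmon [:: y; y'] + zmon [:: z; z'])
  - lam j *: (zmon [:: x; x'] - c0) - (zmon [:: y; y'] - c1)
  - (zmon [:: z; z'] - c2).
  by rewrite scalerBr; ring.
by do !apply: quadricB => //; apply: quadricZ.
Qed.

Definition fermat_rel m M j : S :=
  lam j *: mclass m (addk M (inl false)) + mclass m (addk M (inl true))
  + mclass m (addk M (inr j)).

Lemma fermat_rel_reducible m M j : (1 < m)%N -> adm m (addk M (inr j)) ->
  reducible k.-1 d m (addk M (inr j)) j -> J (fermat_rel m M j).
Proof.
move=> m2 admM red.
have kj : (k.-1 < addk M (inr j) (inr j))%N by rewrite /addk eqxx muln1; lia.
have [P [Q [admP admQ ME Pj]]] :=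
  extract_quadric (canon_degE genus) (canon_deg_gt0 genus) admM m2 kj red.
set P' := subk P (inr j).
have PE : P =1 addk P' (inr j) by apply/subkK/(leq_trans (leqSpred k)).
have ME' l : M l = (P' l + Q l)%N by have := ME l; rewrite PE /addk; lia.
have {}admP : adm 2 (addk P' (inr j)).
  by have [sP leP] := admP; split=> [|i]; rewrite -?PE // -sP; apply: eq_bigr.
have mE : m = (2 + (m - 2))%N by lia.
have J0 : J (mclass m (addk M (inl false)) - mclass 2 (addk P' (inl false)) * mclass (m - 2) Q).
  rewrite [in mclass m _]mE; apply: mclass_mul => //; first exact: addk_admissible admP.
  by move=> i; rewrite /addk ME'; lia.
have J1 : J (mclass m (addk M (inl true)) - mclass 2 (addk P' (inl true)) * mclass (m - 2) Q).
  rewrite [in mclass m _]mE; apply: mclass_mul => //; first exact: addk_admissible admP.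
  by move=> i; rewrite /addk ME'; lia.
have J2 : J (mclass m (addk M (inr j)) - mclass 2 (addk P' (inr j)) * mclass (m - 2) Q).
  rewrite [in mclass m _]mE; apply: mclass_mul => //.
  by move=> i; rewrite /addk ME'; lia.
have J3 := fermat_rel_deg2 admP; rewrite /fermat_rel.
set c0 := mclass _ _ in J0 *; set c1 := mclass _ _ in J1 *; set c2 := mclass _ _ in J2 *.
set q := mclass (m - 2) Q in J0 J1 J2.
set p0 := mclass _ _ in J0 J3; set p1 := mclass _ _ in J1 J3; set p2 := mclass _ _ in J2 J3.
have -> : lam j *: c0 + c1 + c2 =
  lam j *: (c0 - p0 * q) + (c1 - p1 * q) + (c2 - p2 * q)
  + q * (lam j *: p0 + p1 + p2).
  by rewrite -!mul_mpolyC; ring.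
by apply: quadricD; [apply: quadricD; [apply: quadricD => //; apply: quadricZ|] | apply: quadricM].
Qed.

Hypothesis not_special : n.-1 = 1%N -> (4 < k.-1)%N.

(** When the relation at [j] is not reducible, there is [i] such that
    X_(i+2)^k divides M as well.  All the relations at [i] that occur are
    reducible, and so are those at [j] once X_(i+2)^k has been replaced; expanding
    X_(i+2)^k X_(j+2)^k M' in both orders gives the relation at [j]. *)
Lemma fermat_rel_in m M j : (1 < m)%N -> adm m (addk M (inr j)) ->
  J (fermat_rel m M j).
Proof.
move=> m2 admM.
have kj : (k.-1 < addk M (inr j) (inr j))%N by rewrite /addk eqxx muln1; lia.
have [|[i [ij xi redj]]] :=
  reducible_or (canon_degE genus) (canon_deg_gt0 genus) admM m2 kj not_special.
  exact: fermat_rel_reducible.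
have ijE : (inr i == inr j :> bool + 'I_n.-1) = false by exact: negbTE.
have jiE : (inr j == inr i :> bool + 'I_n.-1) = false by rewrite eq_sym.
have kMi : (k <= M (inr i))%N.
  by move: xi; rewrite /excess /addk ijE muln0 addn0; move: ((_ - _) * _)%N => y; lia.
set M' := subk M (inr i).
have ME : M =1 addk M' (inr i) by apply: subkK.
have admi x : adm m (addk (addk M' (inl x)) (inr i)).
  have [sM leM] := addk_admissible x admM; split=> [|l].
    by rewrite -sM; apply: eq_bigr => l _; rewrite /addk ME /addk; lia.
  by have := leM l; rewrite /addk ME /addk; lia.
have admij : adm m (addk (addk M' (inr j)) (inr i)).
  have [sM leM] := admM; split=> [|l].
    by rewrite -sM; apply: eq_bigr => l _; rewrite /addk ME /addk; lia.
  by have := leM l; rewrite /addk ME /addk; lia.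
have Ji x : J (fermat_rel m (addk M' (inl x)) i).
  apply: fermat_rel_reducible => //; apply/orP; left.
  apply: leq_trans xi _; rewrite /excess; apply: leq_sub2r.
  by rewrite /addk ijE eqxx /= ME /addk eqxx; lia.
have Jij : J (fermat_rel m (addk M' (inr j)) i).
  apply: fermat_rel_reducible => //; apply/orP; left.
  apply: leq_trans xi _; rewrite /excess; apply: leq_sub2r.
  by rewrite /addk ijE eqxx /= ME /addk eqxx; lia.
have Jj x : J (fermat_rel m (addk M' (inl x)) j).
  have E l : addk (addk M' (inl x)) (inr j) l = addk (addk M' (inr j)) (inl x) l.
    by rewrite /addk; lia.
  apply: fermat_rel_reducible => //.
    have [sM leM] := addk_admissible x admij; split=> [|l]; last by rewrite E.
    by rewrite -sM; apply: eq_bigr => l _; exact: E.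
  apply: redj => [|l li].
    by rewrite /addk ME /addk ijE eqxx /=; lia.
  rewrite /addk ME /addk -[inr l == inr i]/(l == i) (negbTE li) /=; lia.
have C p q : mclass m (addk (addk M' p) q) = mclass m (addk (addk M' q) p).
  by apply: eq_mclass => l; rewrite /addk; lia.
have E p : mclass m (addk M p) = mclass m (addk (addk M' (inr i)) p).
  by apply: eq_mclass => l; rewrite /addk ME /addk.
move: (Ji false) (Ji true) (Jj false) (Jj true) Jij; rewrite /fermat_rel !E.
rewrite (C (inr j) (inr i)) !(C (inr j) (inl _)) !(C (inr i) (inl _)) (C (inl true) (inl false)).
set x0i := mclass m (addk (addk M' (inl false)) (inr i)).
set x0j := mclass m (addk (addk M' (inl false)) (inr j)).
set x1i := mclass m (addk (addk M' (inl true)) (inr i)).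
set x1j := mclass m (addk (addk M' (inl true)) (inr j)).
set x00 := mclass m (addk _ (inl false)); set x01 := mclass m (addk _ (inl true)).
set x11 := mclass m (addk _ (inl true)); set xij := mclass m (addk _ (inr j)).
move=> J0i J1i J0j J1j {}Jij.
have -> : lam j *: x0i + x1i + xij =
  (lam i *: x0j + x1j + xij)
  - lam i *: (lam j *: x00 + x01 + x0j) - (lam j *: x01 + x11 + x1j)
  + lam j *: (lam i *: x00 + x01 + x0i) + (lam i *: x01 + x11 + x1i).
  by rewrite -!mul_mpolyC; ring.
apply: quadricD => //; apply: quadricD; last exact: quadricZ.
by apply: quadricB => //; apply: quadricB => //; apply: quadricZ.
Qed.

Section NormalForm.
Variable D : nat.
Local Notation B := ('I_D * 'I_(D * d).+1 * {ffun 'I_n.-1 -> 'I_k})%type.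

(** The exponent vector of the monomial of degree [m * d] with exponent [r] in X_1
    and exponents [a] in the bounded variables; it is not admissible when
    [r + |a|] exceeds [m * d]. *)
Definition standard (m r : nat) (a : {ffun 'I_n.-1 -> 'I_k}) (i : bool + 'I_n.-1) : nat :=
  match i with
  | inl true => r
  | inl false => (m * d - r - \sum_j a j)%N
  | inr j => a j
  end.

Definition standard_class (b : B) : S := mclass b.1.1 (standard b.1.1 b.1.2 b.2).

(** A single bound [D] on the degree makes all the normal forms combinations over
    one finite type, so that they can be added. *)
Definition normalizable (f : S) : Prop :=
  exists c : B -> F, J (f - \sum_b c b *: standard_class b).

Lemma normalizableJ f g : J (f - g) -> normalizable g -> normalizable f.
Proof.
by move=> Jfg [c Jg]; exists c; rewrite -(subrKA g); apply: quadricD.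
Qed.

Lemma normalizableD f g : normalizable f -> normalizable g -> normalizable (f + g).
Proof.
move=> [c Jf] [c' Jg]; exists (fun b => c b + c' b).
have -> : \sum_b (c b + c' b) *: standard_class b =
    \sum_b c b *: standard_class b + \sum_b c' b *: standard_class b.
  by rewrite -big_split /=; apply: eq_bigr => b _; rewrite scalerDl.
by rewrite opprD addrACA; apply: quadricD.
Qed.

Lemma normalizableZ a f : normalizable f -> normalizable (a *: f).
Proof.
move=> [c Jf]; exists (fun b => a * c b).
rewrite (eq_bigr (fun b => a *: (c b *: standard_class b))) => [|b _]; last by rewrite scalerA.
by rewrite -scaler_sumr -scalerBr; apply: quadricZ.
Qed.

Lemma normalizable0 : normalizable 0.
Proof.
exists (fun=> 0); rewrite big1 ?subr0; first exact: quadric0.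
by move=> b _; rewrite scale0r.
Qed.

(** Replacing X_(j+2)^k lowers the degree in the bounded variables. *)
Lemma mclass_normalizable m M : (m < D)%N -> adm m M -> normalizable (mclass m M).
Proof.
move=> mD; move Eq: (\sum_j M (inr j))%N => q.
elim/ltn_ind: q M Eq => q IHq M Eq admM.
have [[j kM]|small] : (exists j : 'I_n.-1, (k <= M (inr j))%N) \/
    (forall j : 'I_n.-1, M (inr j) < k)%N.
  have [/forallP|] := boolP [forall j, (M (inr j) < k)%N]; first by right.
  by rewrite negb_forall => /existsP[j]; rewrite -leqNgt; left; exists j.
  set M' := subk M (inr j); have ME : M =1 addk M' (inr j) by apply: subkK.
  have m2 : (1 < m)%N.
    have leM : (M (inr j) <= m * k.-1)%N by have [_ /(_ (inr j))] := admM.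
    by rewrite ltnNge; apply/negP => m1; nia.
  have admM' : adm m (addk M' (inr j)).
    by have [sM leM] := admM; split=> [|l]; rewrite -?ME // -sM; apply: eq_bigr.
  have lt_q x : (\sum_l addk M' (inl x) (inr l) < q)%N.
    rewrite -Eq (bigD1 j) //= [X in (_ < X)%N](bigD1 j) //= -addSn; apply: leq_add.
      rewrite [X in (_ <= X)%N]ME /addk eqxx muln1 muln0 addn0 -[X in (X < _)%N]addn0.
      by rewrite ltn_add2l; lia.
    by apply: leq_sum => l _; rewrite [X in (_ <= X)%N]ME /addk muln0 addn0 leq_addr.
  have nf x : normalizable (mclass m (addk M' (inl x))).
    by apply: (IHq _ (lt_q x)) => //; apply: addk_admissible admM'.
  apply: (@normalizableJ _
    ((- lam j) *: mclass m (addk M' (inl false)) + (-1) *: mclass m (addk M' (inl true)))).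
    rewrite (eq_mclass _ ME); have := fermat_rel_in m2 admM'; rewrite /fermat_rel.
    by congr J; rewrite scaleN1r scaleNr; ring.
  by apply: normalizableD; apply: normalizableZ; apply: nf.
have [sM leM] := admM.
have rP : (M (inl true) < (D * d).+1)%N.
  by rewrite ltnS; apply: leq_trans (leM _) _; rewrite /= leq_mul2r (ltnW mD) orbT.
pose b0 : B := (Ordinal mD, Ordinal rP, [ffun j => Ordinal (small j)]).
exists (fun b => (b == b0)%:R); rewrite (bigD1 b0) //= eqxx scale1r big1 => [|b /negbTE ->].
  rewrite addr0 /standard_class /= (@eq_mclass _ _ M) ?subrr; first exact: quadric0.
  move=> [[]|j] //=; last by rewrite ffunE.
  rewrite (eq_bigr (fun j => M (inr j))) => [|j _]; last by rewrite ffunE.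
  by rewrite -sM sum_split -addnA addKn addnK.
by rewrite scale0r.
Qed.

Lemma zmon_normalizable s : (size s < D)%N -> normalizable (zmon s).
Proof.
move=> sD; apply: normalizableJ (zmon_mclass (M := wt s) _) _ => //.
apply: mclass_normalizable => //; apply: weight_admissible.
  exact: exponent_sum.
exact: exponent_le.
Qed.

End NormalForm.

Lemma mpolyX_zmon (u : 'X_{1..#|{: T}|}) :
  exists2 s : seq T, size s = mdeg u & 'X_[u] = zmon s.
Proof.
exists (flatten [seq nseq (u i) (enum_val i) | i <- enum 'I_#|{: T}|]).
  rewrite size_flatten /shape -map_comp (eq_map (g := u)) => [|i]; last exact: size_nseq.
  by rewrite mdegE sumnE big_map -big_enum.
rewrite mpolyXE_id /zmon big_flatten /= big_map big_enum /=; apply: eq_bigr => i _.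
by rewrite big_nseq /zvar enum_valK iter_mulr_1.
Qed.

Lemma all_normalizable (f : S) : normalizable (msize f) f.
Proof.
rewrite {2}[f]mpolyE big_seq; elim/big_rec: _ => [|u g uf nfg]; first exact: normalizable0.
apply: normalizableD nfg; apply: normalizableZ.
have [s sz ->] := mpolyX_zmon u.
by apply: zmon_normalizable; rewrite sz msize_mdeg_lt.
Qed.

End Reduction.

(** * Points of the curve and linear independence of standard monomials *)

Lemma distinct_roots (K : closedFieldType) (p : {poly K}) :
  (forall z, root p z -> p^`().[z] != 0) ->
  exists rs, [/\ uniq rs, size rs = (size p).-1 & all (root p) rs].
Proof.
move=> sep; have [p0|p0] := eqVneq p 0.
  by have := sep 0; rewrite p0 root0 deriv0 horner0 eqxx => /(_ isT).
have [rs pE] := closed_field_poly_normal p.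
have l0 : lead_coef p != 0 by rewrite lead_coef_eq0.
exists rs; split.
- rewrite -separable_prod_XsubC unlock.
  apply: Pdiv.ClosedField.root_coprimep => z rz.
  have := sep z; rewrite pE rootZ // derivZ hornerZ mulf_eq0 (negbTE l0) /=.
  exact.
- by rewrite pE size_scale // size_prod_XsubC.
- apply/allP => z zrs; rewrite pE rootZ // root_prod_XsubC //.
Qed.

Lemma closed_poly0 (K : closedFieldType) (p q : {poly K}) : q != 0 ->
  (forall t, q.[t] != 0 -> p.[t] = 0) -> p = 0.
Proof.
move=> q0 pq; suff: p * q == 0 by rewrite mulf_eq0 (negbTE q0) orbF => /eqP.
apply: contraT => /closed_nonrootP[t]; rewrite rootE hornerM.
by have [->|/pq ->] := eqVneq q.[t] 0; rewrite ?mulr0 ?mul0r eqxx.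
Qed.

Lemma kth_roots (K : closedFieldType) k (a : K) :
    (0 < k)%N -> k%:R != 0 :> K -> a != 0 ->
  exists2 r : 'I_k -> K, injective r & forall i, r i ^+ k = - a.
Proof.
move=> k0 kK a0; pose p : {poly K} := 'X^k + a%:P.
have rootp z : root p z = (z ^+ k == - a).
  by rewrite rootE /p !hornerE addr_eq0.
have sizep : size p = k.+1.
  by rewrite size_polyDl size_polyXn // (leq_ltn_trans (size_polyC_leq1 _)).
have [z|rs [urs srs allr]] := @distinct_roots _ p.
  rewrite rootp => /eqP za; rewrite derivD derivXn derivC addr0 hornerMn hornerXn.
  rewrite -mulr_natl mulf_neq0 // expf_neq0 //; apply: contraNneq a0 => z0.
  by rewrite -oppr_eq0 -za z0 expr0n (gtn_eqF k0).
rewrite sizep /= in srs.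
exists (fun i => nth 0 rs i) => [i j /eqP|i].
  by rewrite nth_uniq ?srs // => /eqP/val_inj.
by apply/eqP; rewrite -rootp; apply: (allP allr); rewrite mem_nth // srs.
Qed.

(** The Vandermonde matrices of the values in each coordinate are invertible;
    the product of the columns of their inverses extracts one coefficient from
    the values on the grid. *)
Lemma grid_coeffs0 (K : fieldType) N q (r : 'I_N -> 'I_q -> K)
    (c : {ffun 'I_N -> 'I_q} -> K) : (forall j, injective (r j)) ->
    (forall i : {ffun 'I_N -> 'I_q}, \sum_a c a * \prod_j r j (i j) ^+ a j = 0) ->
  forall a, c a = 0.
Proof.
move=> rinj cr a0; pose V j := Vandermonde q (\row_i r j i).
have Vu j : V j \in unitmx.
  rewrite unitmxE unitfE det_Vandermonde; apply/prodf_neq0 => i _.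
  apply/prodf_neq0 => l il; rewrite !mxE subr_eq0.
  by apply: contraTneq il => /rinj ->; rewrite ltnn.
have VW j (e f : 'I_q) : \sum_i r j i ^+ e * invmx (V j) i f = (e == f)%:R.
  have := mulmxV (Vu j) => /matrixP/(_ e f); rewrite !mxE => <-.
  by apply: eq_bigr => i _; rewrite !mxE.
have : \sum_(i : {ffun 'I_N -> 'I_q}) (\prod_j invmx (V j) (i j) (a0 j)) *
    \sum_a c a * \prod_j r j (i j) ^+ a j = 0.
  by apply: big1 => i _; rewrite cr mulr0.
under eq_bigr do rewrite big_distrr /=.
rewrite exchange_big /=.
rewrite (eq_bigr (fun a => c a * (a == a0)%:R)) => [|a _].
  by rewrite (bigD1 a0) //= eqxx mulr1 big1 ?addr0 // => a /negbTE ->; rewrite mulr0.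
have -> : (a == a0)%:R = \prod_j (a j == a0 j)%:R :> K.
  have [->|ne] := eqVneq a a0; first by rewrite big1 // => j _; rewrite eqxx.
  have [j ne'] : exists j, a j != a0 j.
    apply/existsP; rewrite -negb_forall; apply: contra ne => /forallP E.
    by apply/eqP/ffunP => j; apply/eqP.
  by rewrite (bigD1 j) //= (negbTE ne') mul0r.
rewrite (eq_bigr (fun j => \sum_i r j i ^+ a j * invmx (V j) i (a0 j)));
  last by move=> j _; rewrite VW.
rewrite bigA_distr_bigA /= big_distrr /=; apply: eq_bigr => i _.
by rewrite mulrCA -big_split /=; congr (_ * _); apply: eq_bigr => j _; rewrite mulrC.
Qed.

Section FunctionField.
Variables (K L : fieldType) (iota : {rmorphism K -> L}).

Section Eval.
Variables (N : nat) (w : 'I_N.+1 -> L).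
Lemma evalLD f g : evalL iota w (f + g) = evalL iota w f + evalL iota w g.
Proof. by rewrite /evalL !rmorphD. Qed.
Lemma evalLM f g : evalL iota w (f * g) = evalL iota w f * evalL iota w g.
Proof. by rewrite /evalL !rmorphM. Qed.
Lemma evalLXn f q : evalL iota w (f ^+ q) = evalL iota w f ^+ q.
Proof. by rewrite /evalL !rmorphXn. Qed.
Lemma evalLC c : evalL iota w c%:MP = iota c.
Proof. by rewrite /evalL map_mpolyC mevalC. Qed.
Lemma evalLZ c f : evalL iota w (c *: f) = iota c * evalL iota w f.
Proof. by rewrite -mul_mpolyC evalLM evalLC. Qed.
Lemma evalLX i : evalL iota w 'X_i = w i.
Proof. by rewrite /evalL map_mpolyX mevalXU. Qed.
Lemma evalL_sum (I : Type) (r : seq I) (P : pred I) f :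
  evalL iota w (\sum_(i <- r | P i) f i) = \sum_(i <- r | P i) evalL iota w (f i).
Proof. by apply: (big_morph _ evalLD); rewrite /evalL !rmorph0. Qed.
Lemma evalL_prod (I : Type) (r : seq I) (P : pred I) f :
  evalL iota w (\prod_(i <- r | P i) f i) = \prod_(i <- r | P i) evalL iota w (f i).
Proof. by apply: (big_morph _ evalLM); rewrite /evalL !rmorph1. Qed.
Lemma evalLE f : evalL iota w f = \sum_(u <- msupp f) iota f@_u * \prod_i w i ^+ u i.
Proof.
rewrite {1}[f]mpolyE evalL_sum; apply: eq_bigr => u _.
by rewrite evalLZ /evalL map_mpolyX mevalX.
Qed.
End Eval.

Lemma evalL_scale N (w : 'I_N.+1 -> L) c d f : f \is d.-homog ->
  evalL iota (fun i => c * w i) f = c ^+ d * evalL iota w f.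
Proof.
move=> /dhomogP fd; rewrite !evalLE big_distrr /=; apply: eq_big_seq => u uf.
rewrite mulrCA; congr (_ * _).
have <- : mdeg u = d := fd u uf.
rewrite mdegE -prodrXr -big_split /=.
by apply: eq_bigr => i _; rewrite exprMn.
Qed.

(** The definition of the function field speaks of forms; a polynomial in the affine
    coordinates is homogenized by powers of X_0. *)
Lemma affine_vanish N (V : ('I_N.+1 -> K) -> Prop) w (g : {mpoly K[N.+1]}) :
    is_function_field iota V w -> w ord0 != 0 ->
    evalL iota (fun i => w i / w ord0) g = 0 ->
  forall P, V P -> P ord0 = 1 -> g.@[P] = 0.
Proof.
move=> [van _] w0 g0 P VP P0.
pose D := msize g.
pose h := \sum_(u <- msupp g) g@_u *: ('X_ord0 ^+ (D - mdeg u) * 'X_[u]).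
have hh : h \is D.-homog.
  rewrite /h big_seq; apply: rpred_sum => u /msize_mdeg_lt ug; apply: rpredZ.
  have XD : ('X_ord0 : {mpoly K[N.+1]}) ^+ (D - mdeg u) \is (D - mdeg u).-homog.
    by rewrite mpolyXn dhomogX /=; apply/eqP; rewrite [LHS]mdegMn mdeg1 mul1n.
  have Xu : ('X_[u] : {mpoly K[N.+1]}) \is (mdeg u).-homog by rewrite dhomogX.
  by have := dhomogM XD Xu; rewrite subnK // ltnW.
have hP : h.@[P] = g.@[P].
  rewrite /h raddf_sum /= mevalE; apply: eq_bigr => u _.
  by rewrite mevalZ mevalM rmorphXn /= mevalXU mevalX P0 expr1n mul1r.
have hw : evalL iota w h = w ord0 ^+ D * evalL iota (fun i => w i / w ord0) g.
  rewrite /h evalL_sum evalLE big_distrr /= big_seq [RHS]big_seq.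
  apply: eq_bigr => u /msize_mdeg_lt ug.
  rewrite evalLZ evalLM evalLXn evalLX [RHS]mulrCA; congr (_ * _).
  rewrite /evalL map_mpolyX mevalX.
  under [in RHS]eq_bigr do rewrite exprMn exprVn.
  rewrite big_split /= prodfV prodrXr -mdegE mulrCA [LHS]mulrC; congr (_ * _).
  by rewrite expfB_cond // (negbTE w0) /= (ltnW ug).
by rewrite -hP; apply: (van _ _ hh).1 => //; rewrite hw g0 mulr0.
Qed.

End FunctionField.

Section FermatPoints.
Variables (K : closedFieldType) (k n : nat) (lam : 'I_n.-1 -> K).
Local Notation V := (fermat_curve k lam).

Lemma inord0E : inord 0 = ord0 :> 'I_n.+1.
Proof. by apply/val_inj; rewrite /= inordK. Qed.

Lemma fermat_eqE (P : 'I_n.+1 -> K) i : (fermat_eq k lam i).@[P] =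
  lam i * P (inord 0) ^+ k + P (inord 1) ^+ k + P (inord i.+2) ^+ k.
Proof. by rewrite /fermat_eq !mevalD mevalZ !rmorphXn /= !mevalXU. Qed.

Lemma mpolyXexp_homog (R : comNzRingType) m (i : 'I_m) q :
  ('X_i ^+ q : {mpoly R[m]}) \is q.-homog.
Proof. by rewrite mpolyXn dhomogX /=; apply/eqP; rewrite [LHS]mdegMn mdeg1 mul1n. Qed.

Lemma fermat_eq_homog i : fermat_eq k lam i \is k.-homog.
Proof. by rewrite /fermat_eq !rpredD ?rpredZ // mpolyXexp_homog. Qed.

Lemma curveP (P : 'I_n.+1 -> K) : V P <-> (exists i, P i != 0) /\
  forall i, lam i * P (inord 0) ^+ k + P (inord 1) ^+ k + P (inord i.+2) ^+ k = 0.
Proof.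
split=> -[Pn PV]; split=> //; first by move=> i; rewrite -fermat_eqE; apply: PV; exists i.
by move=> g [i ->]; rewrite fermat_eqE.
Qed.

Hypothesis n2 : (2 <= n)%N.

Lemma inord2_lt (j : 'I_n.-1) : (j.+2 < n.+1)%N.
Proof. by have := ltn_ord j; lia. Qed.

Lemma coordinate_cases (i : 'I_n.+1) :
  [\/ i = ord0, i = inord 1 | exists j : 'I_n.-1, i = inord j.+2].
Proof.
case: i => -[|[|j]] ij; [constructor 1 | constructor 2 | constructor 3].
- exact/val_inj.
- by apply/val_inj; rewrite /= inordK.
have jn : (j < n.-1)%N by lia.
by exists (Ordinal jn); apply/val_inj; rewrite /= inordK.
Qed.

(** The point (1 : t : y_2 : ... : y_n). *)
Definition affine_pt (t : K) (y : 'I_n.-1 -> K) (i : 'I_n.+1) : K :=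
  match val i with
  | 0%N => 1
  | 1%N => t
  | j.+2 => if insub j is Some j' then y j' else 0
  end.

Lemma affine_pt0 t y : affine_pt t y ord0 = 1. Proof. by []. Qed.

Lemma affine_pt1 t y : affine_pt t y (inord 1) = t.
Proof. by rewrite /affine_pt /= inordK //; lia. Qed.

Lemma affine_pt2 t y (j : 'I_n.-1) : affine_pt t y (inord j.+2) = y j.
Proof. by rewrite /affine_pt /= inordK ?inord2_lt // insubT //= => ?; congr y; apply: val_inj. Qed.

Lemma affine_ptP t y : (forall j, y j ^+ k = - (lam j + t ^+ k)) -> V (affine_pt t y).
Proof.
move=> yE; apply/curveP; split; first by exists ord0; rewrite affine_pt0 oner_eq0.
by move=> j; rewrite inord0E affine_pt0 affine_pt1 affine_pt2 expr1n mulr1 yE subrr.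
Qed.

Hypothesis kK : k%:R != 0 :> K.

Lemma k_gt0 : (0 < k)%N.
Proof. by case: k kK; rewrite ?mulr0n ?eqxx. Qed.

Lemma kth_root_exists (a : K) : exists y, y ^+ k = a.
Proof.
have [->|a0] := eqVneq a 0; first by exists 0; rewrite expr0n gtn_eqF ?k_gt0.
have [|r _ rE] := @kth_roots _ k (- a) k_gt0 kK; first by rewrite oppr_eq0.
by exists (r (Ordinal k_gt0)); rewrite rE opprK.
Qed.

Section Generic.
Variables (L : fieldType) (iota : {rmorphism K -> L}) (w : 'I_n.+1 -> L).
Hypothesis hL : is_function_field iota V w.
Hypothesis lam0 : forall j, lam j != 0.

Lemma affine_pt_over (t : K) : exists y, V (affine_pt t y).
Proof.
have /fin_all_exists[y yE] j := kth_root_exists (- (lam j + t ^+ k)).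
by exists y; apply: affine_ptP.
Qed.

(** The generic point does not lie in a coordinate hyperplane that some point of the
    curve avoids. *)
Lemma generic_neq0 i P : V P -> P i != 0 -> w i != 0.
Proof.
move=> VP; apply: contraNneq => wi; have [van _] := hL.
have Xh : ('X_i : {mpoly K[n.+1]}) \is 1.-homog by rewrite dhomogX /= mdeg1.
have [/(_ _) van1 _] := van _ _ Xh.
by rewrite -(mevalXU P i) van1 // evalLX.
Qed.

Lemma w0_neq0 : w ord0 != 0.
Proof.
have [y Vy] := affine_pt_over 0; apply: generic_neq0 Vy _.
by rewrite affine_pt0 oner_eq0.
Qed.

Lemma w1_neq0 : w (inord 1) != 0.
Proof.
have [y Vy] := affine_pt_over 1; apply: generic_neq0 Vy _.
by rewrite affine_pt1 oner_eq0.
Qed.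

Lemma w2_neq0 (j : 'I_n.-1) : w (inord j.+2) != 0.
Proof.
have /fin_all_exists[y yE] i := kth_root_exists (- (lam i + 0 ^+ k)).
apply: (generic_neq0 (affine_ptP yE)); rewrite affine_pt2.
apply: contraNneq (lam0 j) => y0; have := yE j.
by rewrite y0 expr0n gtn_eqF ?k_gt0 // addr0 => /eqP; rewrite eq_sym oppr_eq0.
Qed.

Local Notation x := (coord_x w).
Local Notation y := (coord_y w).

Lemma x_neq0 : x != 0.
Proof. by rewrite mulf_neq0 ?invr_eq0 ?inord0E ?w1_neq0 ?w0_neq0. Qed.

Lemma y_neq0 j : y j != 0.
Proof. by rewrite mulf_neq0 ?invr_eq0 ?inord0E ?w2_neq0 ?w0_neq0. Qed.

Lemma fermat_xy j : iota (lam j) + x ^+ k + y j ^+ k = 0.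
Proof.
have : evalL iota w (fermat_eq k lam j) = 0.
  apply/(hL.1 _ _ (fermat_eq_homog j)) => P /curveP[_ PV].
  by rewrite fermat_eqE.
rewrite /fermat_eq !evalLD evalLZ !evalLXn !evalLX => E.
have w0 : w (inord 0) ^+ k != 0 by rewrite inord0E expf_neq0 ?w0_neq0.
by apply: (mulIf w0); rewrite mul0r -E /coord_x /coord_y !expr_div_n; field.
Qed.

(** The relation holds at the points of the curve.  Above a value t of x with
    lambda_j + t^k <> 0 for all j, they form a grid, so each coefficient, as a
    polynomial in t, vanishes for all those t. *)
Lemma monomials_free A (c : 'I_A * {ffun 'I_n.-1 -> 'I_k} -> K) :
    \sum_b iota (c b) * (x ^+ b.1 * \prod_j y j ^+ b.2 j) = 0 ->
  forall b, c b = 0.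
Proof.
move=> c0 [r0 a0].
pose g : {mpoly K[n.+1]} :=
  \sum_b c b *: ('X_(inord 1) ^+ b.1 * \prod_(j < n.-1) 'X_(inord j.+2) ^+ b.2 j).
have g0 : evalL iota (fun i => w i / w ord0) g = 0.
  rewrite -[RHS]c0 evalL_sum; apply: eq_bigr => b _.
  rewrite evalLZ evalLM evalLXn evalLX evalL_prod /coord_x /coord_y inord0E.
  by congr (_ * (_ * _)); apply: eq_bigr => j _; rewrite evalLXn evalLX.
have gP P : V P -> P ord0 = 1 ->
    \sum_b c b * (P (inord 1) ^+ b.1 * \prod_(j < n.-1) P (inord j.+2) ^+ b.2 j) = 0.
  move=> VP P0; rewrite -[RHS](affine_vanish hL w0_neq0 g0 VP P0) raddf_sum /=.
  apply: eq_bigr => b _; rewrite mevalZ mevalM rmorphXn /= mevalXU rmorph_prod /=.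
  by congr (_ * (_ * _)); apply: eq_bigr => j _; rewrite rmorphXn /= mevalXU.
pose q : {poly K} := \prod_j ((lam j)%:P + 'X^k).
have q0 : q != 0.
  apply/prodf_neq0 => j _; apply: contraNneq (lam0 j) => E.
  have := congr1 (fun p : {poly K} => p.[0]) E.
  by rewrite /= hornerD hornerXn !hornerC expr0n gtn_eqF ?k_gt0 // addr0 => /eqP.
suff : \poly_(r < A) (if insub r is Some r' then c (r', a0) else 0) = 0.
  move/(congr1 (fun p : {poly K} => p`_r0)); rewrite coef_poly ltn_ord coef0.
  by rewrite valK.
apply: (closed_poly0 q0) => t; rewrite horner_prod => /prodf_neq0 qt.
have /fin_all_exists2[r rinj rE] j : exists2 r : 'I_k -> K,
    injective r & forall i, r i ^+ k = - (lam j + t ^+ k).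
  apply: kth_roots k_gt0 kK _.
  by have := qt j isT; rewrite hornerD hornerC hornerXn.
have := grid_coeffs0 (c := [ffun a => \sum_(r < A) c (r, a) * t ^+ r]) rinj.
move=> /(_ _ a0); rewrite ffunE horner_poly => E; rewrite -[RHS]E.
  by apply: eq_bigr => i _; rewrite valK.
move=> i; rewrite -[RHS](gP (affine_pt t (fun j => r j (i j)))) //; last first.
  by apply: affine_ptP => j; rewrite rE.
rewrite (eq_bigr (fun a => \sum_(r1 < A) c (r1, a) * (t ^+ r1 * \prod_j r j (i j) ^+ a j))).
  rewrite exchange_big pair_bigA /=; apply: eq_bigr => -[r1 a] _ /=.
  rewrite affine_pt1; congr (_ * (_ * _)).
  by apply: eq_bigr => j _; rewrite affine_pt2.
by move=> a _; rewrite ffunE big_distrl /=; apply: eq_bigr => r1 _; rewrite mulrA.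
Qed.

End Generic.
End FermatPoints.

(** * The kernel of the canonical map *)

Section CanonicalMap.
Variables (K : closedFieldType) (k n : nat) (lam : 'I_n.-1 -> K).
Variables (L : fieldType) (iota : {rmorphism K -> L}) (w : 'I_n.+1 -> L).
Local Notation x := (coord_x w).
Local Notation y := (coord_y w).
Local Notation T := (index1 k n).
Local Notation S := {mpoly K[#|{: T}|]}.
Local Notation phi := (canonical_map iota w : S -> {poly L}).

Lemma canonical_mapD f g : phi (f + g) = phi f + phi g.
Proof. by rewrite /canonical_map rmorphD. Qed.
Lemma canonical_mapM f g : phi (f * g) = phi f * phi g.
Proof. by rewrite /canonical_map rmorphM. Qed.
Lemma canonical_mapC c : phi c%:MP = (iota c)%:P.
Proof. by rewrite /canonical_map mmapC. Qed.
Lemma canonical_mapZ c f : phi (c *: f) = iota c *: phi f.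
Proof. by rewrite -mul_mpolyC canonical_mapM canonical_mapC mul_polyC. Qed.
Lemma canonical_map0 : phi 0 = 0.
Proof. by rewrite /canonical_map rmorph0. Qed.
Lemma canonical_mapB f g : phi (f - g) = phi f - phi g.
Proof. by rewrite /canonical_map rmorphB. Qed.
Lemma canonical_map_sum (I : Type) (r : seq I) (P : pred I) f :
  phi (\sum_(i <- r | P i) f i) = \sum_(i <- r | P i) phi (f i).
Proof. by apply: (big_morph _ canonical_mapD); apply: canonical_map0. Qed.
Lemma canonical_map_zvar s : phi (zvar K s) = theta w s *: 'X.
Proof. by rewrite /canonical_map /zvar mmapX mmap1U enum_rankK. Qed.

Hypothesis y_neq0 : forall j, y j != 0.
Hypothesis k2 : (2 <= k)%N.
Hypothesis fermat : forall j, iota (lam j) + x ^+ k + y j ^+ k = 0.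

Local Notation J := (quadric_ideal lam).

Definition xy_monomial (r : nat) (a : 'I_n.-1 -> nat) : L := x ^+ r * \prod_j y j ^+ a j.

(** The differential dx / (y_2 ... y_n)^(k-1) corresponds to the monomial X_0^d, so
    dividing by it turns theta_{r,a} into a monomial in x and the y_j. *)
Definition y_power : L := \prod_j y j ^+ k.-1.

Lemma y_power_neq0 : y_power != 0.
Proof. by apply/prodf_neq0 => j _; rewrite expf_neq0. Qed.

Lemma theta_xy_monomial (s : T) :
  theta w s = xy_monomial (exponent (s : T) (inl true)) (fun j => exponent s (inr j)) / y_power.
Proof.
rewrite /theta /xy_monomial -mulrA; congr (_ * _); rewrite -!prodfV -big_split /=.
apply: eq_bigr => j _; have ak := idx_a_lt s j.
have -> : y j ^+ k.-1 = y j ^+ (k.-1 - idx_a s j) * y j ^+ idx_a s j.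
  by rewrite -exprD subnK //; lia.
by rewrite invfM mulrA divff ?mul1r // expf_neq0.
Qed.

Lemma canonical_map_zmon s : phi (zmon K s) =
  (xy_monomial (weight (@exponent k n) s (inl true)) (fun j => weight (@exponent k n) s (inr j))
   / y_power ^+ size s) *: 'X^(size s).
Proof.
elim: s => [|t s IHs].
  rewrite /zmon big_nil -[1]/(1%:MP) canonical_mapC rmorph1 /xy_monomial /weight !big_nil expr0.
  by rewrite big1 //= ?expr0 ?mulr1 ?invr1 ?mulr1 ?scale1r // => j _; rewrite big_nil.
rewrite zmon_cons canonical_mapM canonical_map_zvar IHs theta_xy_monomial.
rewrite -scalerAl -scalerAr scalerA.
rewrite -exprS -[size (t :: s)]/(size s).+1.
congr (_ *: _); rewrite /xy_monomial !weight_cons exprD.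
rewrite [in RHS](eq_bigr (fun j => y j ^+ exponent t (inr j) *
  y j ^+ weight (@exponent k n) s (inr j))); last by move=> j _; rewrite weight_cons exprD.
by rewrite big_split /= exprS invfM; ring.
Qed.

Lemma quadric_ideal_in_kernel f : J f -> phi f = 0.
Proof.
move=> [q [c [g [Gg ->]]]]; rewrite canonical_map_sum big1 // => i _.
rewrite canonical_mapM; suff -> : phi (g i) = 0 by rewrite mulr0.
have zz a b : zvar K a * zvar K b = zmon K [:: a; b].
  by rewrite !zmon_cons /zmon big_nil mulr1.
have wE a b : weight (@exponent k n) [:: a; b] (inl true) = (idx_r a + idx_r b)%N.
  by rewrite /weight !big_cons big_nil addn0.
have wE' a b j : weight (@exponent k n) [:: a; b] (inr j) =
    (k.-1 - idx_a a j + (k.-1 - idx_a b j))%N.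
  by rewrite /weight !big_cons big_nil addn0.
case: (Gg i) => [[a [b [a' [b' [rE aE ->]]]]]|].
  rewrite canonical_mapB !zz !canonical_map_zmon !wE rE; apply/eqP; rewrite subr_eq0; apply/eqP.
  congr ((_ * _ / _) *: _); apply: eq_bigr => j _; rewrite !wE'; congr (_ ^+ _).
  have := aE j; have := idx_a_lt a j; have := idx_a_lt b j.
  by have := idx_a_lt a' j; have := idx_a_lt b' j; lia.
move=> [j [a [b [a' [b' [a'' [b'' [[rE aE] [rE' aE'] ->]]]]]]]].
rewrite !canonical_mapD canonical_mapZ !zz !canonical_map_zmon !wE /= rE rE'.
set M := xy_monomial _ _; set M' := xy_monomial _ _; set M'' := xy_monomial _ _.
have M'E : M' = x ^+ k * M.
  rewrite /M' /M /xy_monomial exprD -!mulrA mulrCA; congr (_ * (_ * _)).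
  apply: eq_bigr => l _; rewrite !wE'; congr (_ ^+ _); have := aE l.
  have := idx_a_lt a l; have := idx_a_lt b l.
  by have := idx_a_lt a' l; have := idx_a_lt b' l; lia.
have M''E : M'' = y j ^+ k * M.
  have yk : y j ^+ k = \prod_l y l ^+ (if l == j then k else 0%N).
    by rewrite (bigD1 j) //= eqxx big1 ?mulr1 // => l /negbTE ->; rewrite expr0.
  rewrite /M'' /M /xy_monomial mulrCA; congr (_ * _); rewrite yk -big_split /=.
  apply: eq_bigr => l _; rewrite !wE' -exprD; congr (_ ^+ _); have := aE' l.
  have := idx_a_lt a l; have := idx_a_lt b l.
  by have := idx_a_lt a'' l; have := idx_a_lt b'' l; case: (l == j); lia.
rewrite scalerA -!scalerDl M'E M''E; set U := _^-1.
have -> : iota (lam j) * (M * U) + x ^+ k * M * U + y j ^+ k * M * U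
  = (iota (lam j) + x ^+ k + y j ^+ k) * (M * U) by ring.
by rewrite fermat mul0r scale0r.
Qed.

Hypothesis genus : (2 < n.-1 * k.-1)%N.
Hypothesis not_special : n.-1 = 1%N -> (4 < k.-1)%N.
Hypothesis free : forall A (c : 'I_A * {ffun 'I_n.-1 -> 'I_k} -> K),
  \sum_b iota (c b) * (x ^+ b.1 * \prod_j y j ^+ b.2 j) = 0 -> forall b, c b = 0.

Lemma canonical_map_cls m M (s : m.-tuple T) : weight (@exponent k n) s =1 M ->
  phi (mclass K k m M) = (xy_monomial (M (inl true)) (fun j => M (inr j)) / y_power ^+ m) *: 'X^m.
Proof.
move=> sM; rewrite /mclass; case: pickP => [t /forallP tM|/(_ s)]; last first.
  by case/negP; apply/forallP => i; rewrite sM.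
rewrite canonical_map_zmon size_tuple /xy_monomial (eqP (tM _)); congr ((_ * _ / _) *: _).
by apply: eq_bigr => j _; rewrite (eqP (tM _)).
Qed.

Lemma standard_admissible m r (a : {ffun 'I_n.-1 -> 'I_k}) :
    (r + \sum_j a j <= m * canon_deg k n)%N ->
  admissible (cap k.-1 (canon_deg k n)) (canon_deg k n) m (standard m r a).
Proof.
move=> ra; set A := (\sum_j a j)%N in ra; split=> [|[[]|j] /=].
- by rewrite sum_split /= -/A; lia.
- by apply: leq_trans ra; apply: leq_addr.
- by rewrite -subnDA leq_subr.
have aA : (a j <= A)%N by rewrite /A (bigD1 j) //= leq_addr.
case: m ra => [|m] ra; first by rewrite mul0n; lia.
by apply: leq_trans (leq_pmull _ _); have := ltn_ord (a j); lia.
Qed.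

(** An element is congruent to its normal form, whose image in degree m is a
    combination of linearly independent monomials. *)
Lemma kernel_in_quadric_ideal f : phi f = 0 -> J f.
Proof.
move=> f0; have [c Jc] := all_normalizable lam k2 genus not_special f.
set D := msize f in c Jc *; set d := canon_deg k n in c Jc *.
pose good (b : 'I_D * 'I_(D * d).+1 * {ffun 'I_n.-1 -> 'I_k}) :=
  (b.1.2 + \sum_j b.2 j <= b.1.1 * d)%N.
have not_good b : ~~ good b -> standard_class K b = 0.
  move=> bad; rewrite /standard_class /mclass; case: pickP => // t /forallP tM.
  case/negP: bad; have [sE _] := weight_admissible (exponent_sum genus k2) (exponent_le genus k2) t.
  rewrite size_tuple in sE; rewrite /good -/d -sE sum_split !(eqP (tM _)) /=.
  rewrite addnAC; apply: leq_trans (leq_addr _ _).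
  by rewrite leq_add2l; apply: eq_leq; apply: eq_bigr => j _; rewrite (eqP (tM _)).
have phi_good b : good b -> phi (standard_class K b) =
    (xy_monomial b.1.2 (fun j => b.2 j : nat) / y_power ^+ b.1.1) *: 'X^(b.1.1).
  move=> gb; have [s [sz sM _]] := admissible_zmon lam k2 genus (standard_admissible gb).
  by rewrite /standard_class -sz; apply: (@canonical_map_cls _ _ (in_tuple s)) => i; rewrite sM sz.
have : phi (\sum_b c b *: standard_class K b) = 0.
  have := quadric_ideal_in_kernel Jc.
  by rewrite canonical_mapB f0 sub0r => /eqP; rewrite oppr_eq0 => /eqP.
rewrite canonical_map_sum => sum0.
suff -> : f = f - \sum_b c b *: standard_class K b by [].
rewrite big1 ?subr0 // => b _; have [gb|/not_good ->] := boolP (good b); last first.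
  by rewrite scaler0.
suff -> : c b = 0 by rewrite scale0r.
pose c' p := if good (b.1.1, p.1, p.2) then c (b.1.1, p.1, p.2) else 0.
have := @free _ c' _ (b.1.2, b.2); rewrite /c' /= -!surjective_pairing gb.
apply; have W0 : y_power ^+ b.1.1 != 0 by rewrite expf_neq0 ?y_power_neq0.
apply: (mulIf (invr_neq0 W0)); rewrite mul0r big_distrl /=.
have := congr1 (fun p : {poly L} => p`_b.1.1) sum0; rewrite /= coef0 => E; rewrite -[RHS]E {E}.
rewrite coef_sum; pose G m r a := (phi (c (m, r, a) *: standard_class K (m, r, a)))`_(b.1.1).
rewrite [RHS](_ : _ = \sum_m \sum_r \sum_a G m r a); last first.
  by rewrite !pair_bigA; apply: eq_bigr => -[[m r] a].
rewrite (bigD1 b.1.1) //= [X in _ = _ + X]big1 ?addr0 => [|m mb]; last first.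
  rewrite big1 // => r _; rewrite big1 // => a _; rewrite /G canonical_mapZ coefZ.
  have [g|/not_good ->] := boolP (good (m, r, a)); last by rewrite canonical_map0 coef0 mulr0.
  by rewrite phi_good // coefZ coefXn eq_sym (inj_eq val_inj) (negbTE mb) !mulr0.
rewrite pair_bigA /=; apply: eq_bigr => -[r a] _ /=; rewrite /G canonical_mapZ coefZ /c' /=.
case: ifP => [g|/negbT/not_good ->]; last by rewrite rmorph0 canonical_map0 coef0 !mul0r mulr0.
by rewrite phi_good // coefZ coefXn eqxx mulr1 -[LHS]mulrA.
Qed.

End CanonicalMap.

(** * Regularity of the differentials *)

Section Derivations.
Variables (K L : fieldType) (iota : {rmorphism K -> L}) (D : L -> L).
Hypothesis derD : derivation iota D.

Lemma der0 : D 0 = 0.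
Proof. by have [_ _ DC] := derD; rewrite -[X in D X](rmorph0 iota) DC. Qed.

Lemma der1 : D 1 = 0.
Proof. by have [_ _ DC] := derD; rewrite -[X in D X](rmorph1 iota) DC. Qed.

Lemma derX u q : D (u ^+ q) = q%:R * u ^+ q.-1 * D u.
Proof.
have [_ DM _] := derD; elim: q => [|q IHq]; first by rewrite !mul0r der1.
rewrite exprS DM IHq /= -natr1; case: q {IHq} => [|q] /=; last by rewrite exprS; ring.
by rewrite expr0 !mul0r; ring.
Qed.

Lemma derV u : u != 0 -> D u^-1 = - u ^- 2 * D u.
Proof.
move=> u0; have [_ DM _] := derD; have := DM u u^-1.
rewrite divff // der1 => E; apply: (mulfI u0).
have -> : u * D u^-1 = - (D u * u^-1).
  by apply/eqP; rewrite -addr_eq0 addrC -E.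
by field.
Qed.

End Derivations.

Section LocalRing.
Variables (K L : fieldType) (iota : {rmorphism K -> L}) (N : nat).
Variables (V : ('I_N.+1 -> K) -> Prop) (w : 'I_N.+1 -> L) (P : 'I_N.+1 -> K).
Hypothesis hL : is_function_field iota V w.
Hypothesis VP : V P.
Local Notation O := (local_ring iota w P).

(** A denominator that does not vanish at a point of the curve is not zero in the
    function field. *)
Lemma den_neq0 d (g : {mpoly K[N.+1]}) : g \is d.-homog -> g.@[P] != 0 ->
  evalL iota w g != 0.
Proof.
by move=> gd; apply: contraNneq => g0; rewrite ((hL.1 _ _ gd).1 g0).
Qed.

Lemma localC c : O (iota c).
Proof.
exists 0%N, c%:MP, 1; split.
- by rewrite -[c%:MP]mulr1 mul_mpolyC rpredZ ?dhomog1.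
- exact: dhomog1.
- by rewrite meval1 oner_eq0.
by rewrite evalLC /evalL !rmorph1 divr1.
Qed.

Lemma localM u v : O u -> O v -> O (u * v).
Proof.
move=> [d [f [g [fd gd g0 ->]]]] [d' [f' [g' [fd' gd' g0' ->]]]].
exists (d + d')%N, (f * f'), (g * g'); split; rewrite ?dhomogM //.
  by rewrite mevalM mulf_neq0.
by rewrite !evalLM mulf_div.
Qed.

Lemma localD u v : O u -> O v -> O (u + v).
Proof.
move=> [d [f [g [fd gd g0 ->]]]] [d' [f' [g' [fd' gd' g0' ->]]]].
exists (d + d')%N, (f * g' + f' * g), (g * g'); split.
- rewrite rpredD //; first by apply: dhomogM.
  by rewrite addnC; apply: dhomogM.
- by rewrite dhomogM.
- by rewrite mevalM mulf_neq0.
by rewrite evalLD !evalLM addf_div //; apply: den_neq0; eassumption.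
Qed.

Lemma localN u : O u -> O (- u).
Proof. by move=> Ou; rewrite -mulN1r -(rmorphN1 iota); apply: localM => //; apply: localC. Qed.

Lemma local1 : O 1. Proof. by rewrite -(rmorph1 iota); apply: localC. Qed.

Lemma local0 : O 0. Proof. by rewrite -(rmorph0 iota); apply: localC. Qed.

Lemma localX u q : O u -> O (u ^+ q).
Proof.
move=> Ou; elim: q => [|q IHq]; first exact: local1.
by rewrite exprS; apply: localM.
Qed.

Lemma local_prod (I : finType) (Q : pred I) (f : I -> L) :
  (forall i, Q i -> O (f i)) -> O (\prod_(i | Q i) f i).
Proof. by move=> Of; elim/big_ind: _ => //; [apply: local1 | apply: localM]. Qed.

Lemma local_frac i j : P j != 0 -> O (w i / w j).
Proof.
move=> Pj; exists 1%N, 'X_i, 'X_j; split; rewrite ?dhomogX /= ?mdeg1 ?mevalXU //.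
by rewrite !evalLX.
Qed.

End LocalRing.

Section Regularity.
Variables (K : closedFieldType) (k n : nat) (lam : 'I_n.-1 -> K).
Hypothesis kK : k%:R != 0 :> K.
Hypothesis n2 : (2 <= n)%N.
Hypothesis lam0 : forall j, lam j != 0.
Hypothesis lam_inj : injective lam.
Local Notation V := (fermat_curve k lam).
Variables (L : fieldType) (iota : {rmorphism K -> L}) (w : 'I_n.+1 -> L).
Hypothesis hL : is_function_field iota V w.
Local Notation x := (coord_x w).
Local Notation y := (coord_y w).
Local Notation T := (index1 k n).
Local Notation phi := (@canonical_map k n K L iota w).

(** The differential of [g] generates the canonical sheaf at [P].  If P_0 = 0, then
    g = 1/x; otherwise g = x, unless some y_j vanishes at [P], in which case
    g = y_j.  At most one y_j can vanish since the lambda_j are distinct, and x and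
    y_j do not vanish together. *)
Lemma local_generator P : V P -> exists g h, [/\ local_ring iota w P g,
  differential_eq iota x g h
  & forall s : T, exists2 c, local_ring iota w P c & theta w s = c * h].
Proof.
move=> VP; have [[i0 Pi0] PV] := (curveP k lam P).1 VP.
have k0 := k_gt0 kK.
have x0 : x != 0 := x_neq0 n2 kK hL.
have y0 j : y j != 0 := y_neq0 n2 kK hL lam0 j.
have w0 : w ord0 != 0 := w0_neq0 n2 kK hL.
have w1 : w (inord 1) != 0 := w1_neq0 n2 kK hL.
have w2 (j : 'I_n.-1) : w (inord j.+2) != 0 := w2_neq0 n2 kK hL lam0 j.
have kL : k%:R != 0 :> L by rewrite -(rmorph_nat iota) fmorph_eq0.
have frac i j : P j != 0 -> local_ring iota w P (w i / w j) := @local_frac _ _ iota _ w P i j.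
have [P0|P0] := eqVneq (P ord0) 0.
  have P1 : P (inord 1) != 0.
    apply: contraNneq Pi0 => P1.
    case: (coordinate_cases n2 i0) => [->|->|[j ->]]; rewrite ?P0 ?P1 //.
    have := PV j; rewrite inord0E P0 P1 expr0n gtn_eqF // mulr0 !add0r => /eqP.
    by rewrite expf_eq0 k0.
  have P2 (j : 'I_n.-1) : P (inord j.+2) != 0.
    apply: contraNneq P1 => Pj; have := PV j.
    rewrite inord0E P0 Pj expr0n gtn_eqF // mulr0 addr0 add0r => /eqP.
    by rewrite expf_eq0 k0.
  (* 1 / x, with d(1/x) = - dx / x^2; the exponent |a| - (r + 2) below is
     nonnegative because (r, a) is an index. *)
  exists (w ord0 / w (inord 1)), (- x ^- 2); split; first exact: frac.
    move=> D Dd; rewrite -(derV Dd x0); congr D.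
    by rewrite /coord_x invf_div inord0E.
  move=> s; pose q := (\sum_j idx_a s j - (idx_r s + 2))%N.
  exists (- ((w ord0 / w (inord 1)) ^+ q *
             \prod_(j < n.-1) (w (inord 1) / w (inord j.+2)) ^+ idx_a s j)).
    apply/localN/localM; first exact/localX/frac.
    by apply: local_prod => j _; apply/localX/frac.
  rewrite mulrNN /theta.
  have -> : w ord0 / w (inord 1) = x^-1 by rewrite /coord_x invf_div inord0E.
  have -> : \prod_(j < n.-1) (w (inord 1) / w (inord j.+2)) ^+ idx_a s j =
      x ^+ (\sum_j idx_a s j) / \prod_j y j ^+ idx_a s j.
    rewrite -prodrXr -prodf_div; apply: eq_bigr => j _.
    by rewrite -expr_div_n /coord_x /coord_y inord0E; congr (_ ^+ _); field; apply/andP.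
  have -> : (\sum_j idx_a s j)%N = (q + (idx_r s + 2))%N.
    by rewrite subnK // idx_r_le.
  rewrite !exprD exprVn; field.
  by rewrite x0 expf_neq0 //= andbT; apply/prodf_neq0 => j _; rewrite expf_neq0.
have Ox : local_ring iota w P x by rewrite /coord_x inord0E; apply: frac.
have Oy j : local_ring iota w P (y j) by rewrite /coord_y inord0E; apply: frac.
have OyV (j : 'I_n.-1) : P (inord j.+2) != 0 -> local_ring iota w P (y j)^-1.
  by move=> Pj; rewrite /coord_y invf_div inord0E; apply: frac.
have [/existsP[j /eqP Pj]|] := boolP [exists j : 'I_n.-1, P (inord j.+2) == 0]; last first.
  rewrite negb_exists => /forallP P2.
  exists x, 1; split=> //; first by move=> D _; rewrite mul1r.
  move=> s; exists (theta w s); last by rewrite mulr1.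
  rewrite /theta -prodfV; apply: localM; first exact: localX.
  by apply: local_prod => j _; rewrite -exprVn; apply/localX/OyV.
have lamP : P (inord 1) ^+ k = - (lam j * P ord0 ^+ k).
  have := PV j; rewrite inord0E Pj expr0n gtn_eqF // addr0 => /eqP.
  by rewrite addrC addr_eq0 => /eqP.
have P1 : P (inord 1) != 0.
  apply/eqP => P1; move/eqP: lamP; rewrite P1 expr0n gtn_eqF // eq_sym oppr_eq0.
  by rewrite mulf_eq0 (negbTE (lam0 j)) expf_eq0 k0 (negbTE P0).
have P2 (i : 'I_n.-1) : i != j -> P (inord i.+2) != 0.
  apply: contraNneq => Pi; have := PV i.
  rewrite inord0E Pi expr0n gtn_eqF // addr0 lamP -mulrBl => /eqP.
  by rewrite mulf_eq0 expf_eq0 k0 (negbTE P0) orbF subr_eq0 (inj_eq lam_inj).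
have OxV : local_ring iota w P x^-1 by rewrite /coord_x invf_div inord0E; apply: frac.
(* From x^(k-1) dx + y_j^(k-1) dy_j = 0. *)
exists (y j), (- (x ^+ k.-1 / y j ^+ k.-1)); split=> //.
  move=> D Dd; have [DD DM DC] := Dd.
  have yk : y j ^+ k.-1 != 0 by rewrite expf_neq0.
  have := congr1 D (fermat_xy n2 kK hL j).
  rewrite !DD DC (der0 Dd) !(derX Dd) add0r -!mulrA -mulrDr => /eqP.
  rewrite mulf_eq0 (negbTE kL) /= addrC addr_eq0 => /eqP E.
  by apply: (mulfI yk); rewrite E; field.
move=> s; have ak := idx_a_lt s j.
exists (- (x ^+ idx_r s * x^-1 ^+ k.-1 * y j ^+ (k.-1 - idx_a s j) *
   \prod_(i | i != j) (y i)^-1 ^+ idx_a s i)).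
  apply: localN; apply: localM; last first.
    by apply: local_prod => i ij; apply/localX/OyV/P2.
  by apply: localM; [apply: localM|]; apply: localX.
rewrite mulrNN /theta (bigD1 j) //=.
have -> : \prod_(i | i != j) (y i)^-1 ^+ idx_a s i = (\prod_(i | i != j) y i ^+ idx_a s i)^-1.
  by rewrite -prodfV; apply: eq_bigr => i _; rewrite exprVn.
have -> : y j ^+ k.-1 = y j ^+ (k.-1 - idx_a s j) * y j ^+ idx_a s j.
  by rewrite -exprD subnK //; lia.
rewrite exprVn; field; rewrite !expf_neq0 //= ?andbT.
by apply/prodf_neq0 => i _; rewrite expf_neq0.
Qed.

Lemma canonical_map_zmon_theta (s : seq T) :
  phi (zmon K s) = (\prod_(t <- s) theta w t) *: 'X^(size s).
Proof.
elim: s => [|t s IHs].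
  by rewrite /zmon !big_nil -[1]/(1%:MP) canonical_mapC rmorph1 scale1r.
rewrite zmon_cons canonical_mapM canonical_map_zvar IHs big_cons.
by rewrite -scalerAl -scalerAr scalerA -exprS.
Qed.

(** A product of m of the theta_{r,a} is a multiple of the same m-th power of dg. *)
Lemma canonical_map_regular f : canonical_ring iota V w x (phi f).
Proof.
move=> m P VP; have [g [h [Og dg gen]]] := local_generator VP.
suff [C OC ->] : exists2 C, local_ring iota w P C & (phi f)`_m = C * h ^+ m.
  exists 1%N, (fun=> C), (fun _ _ => g), (fun _ _ => h); split=> //.
  by rewrite big_ord1 prodr_const card_ord.
rewrite [f]mpolyE; elim/big_rec: _ => [|u p _ [C OC CE]].
  by exists 0; [apply: local0 | rewrite canonical_map0 coef0 mul0r].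
have [s _ ->] := mpolyX_zmon K u.
have [C' OC' CE'] : exists2 C, local_ring iota w P C &
    \prod_(t <- s) theta w t = C * h ^+ size s.
  elim: s => [|t s [C' OC' IHs]]; first by exists 1; [apply: local1 | rewrite big_nil mul1r].
  have [c Oc cE] := gen t; exists (c * C'); first exact: localM.
  by rewrite big_cons IHs cE exprS; ring.
exists (iota f@_u * (if m == size s then C' else 0) + C).
  apply: localD hL VP _ _ _ _ => //; apply: localM; first exact: localC.
  by case: ifP => // _; apply: local0.
rewrite canonical_mapD canonical_mapZ coefD coefZ CE.
rewrite canonical_map_zmon_theta coefZ coefXn mulrDl; congr (_ + _).
case: eqP => [->|_]; first by rewrite CE' mulr1 mulrA.
by rewrite !mulr0 mul0r.
Qed.

End Regularity.

(** * The Fermat quartic is trigonal *)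

Lemma quadratic_3roots (K : idomainType) (a b c : K) (rs : seq K) :
    uniq rs -> (2 < size rs)%N -> all (fun z => a + b * z + c * z ^+ 2 == 0) rs ->
  [/\ a = 0, b = 0 & c = 0].
Proof.
move=> urs srs allr; pose p := Poly [:: a; b; c].
have p0 : p = 0.
  apply: (roots_geq_poly_eq0 _ urs).
    apply: sub_all allr => z /eqP E; rewrite rootE /p horner_Poly /=.
    by apply/eqP; rewrite -[RHS]E; ring.
  by apply: leq_trans srs; apply: size_Poly.
have cE i : p`_i = 0 by rewrite p0 coef0.
by split; [have := cE 0%N | have := cE 1%N | have := cE 2%N]; rewrite coef_Poly.
Qed.

Section SimpleSubfield.
Variables (K L : fieldType) (iota : {rmorphism K -> L}) (f : L).
Local Notation E := (in_simple_subfield iota f).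

Lemma simple_poly p : E (map_poly iota p).[f].
Proof. by exists p, 1; rewrite rmorph1 hornerC divr1 oner_eq0. Qed.

Lemma simpleC c : E (iota c).
Proof. by have := simple_poly c%:P; rewrite map_polyC hornerC. Qed.

Lemma simple_gen : E f.
Proof. by have := simple_poly 'X; rewrite map_polyX hornerX. Qed.

Lemma simpleD u v : E u -> E v -> E (u + v).
Proof.
move=> [p [q [q0 ->]]] [p' [q' [q0' ->]]].
exists (p * q' + p' * q), (q * q'); rewrite !(rmorphD, rmorphM) /= !(hornerD, hornerM).
by rewrite mulf_neq0 //; split=> //; field; apply/andP.
Qed.

Lemma simpleM u v : E u -> E v -> E (u * v).
Proof.
move=> [p [q [q0 ->]]] [p' [q' [q0' ->]]].
exists (p * p'), (q * q'); rewrite !rmorphM /= !hornerM.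
by rewrite mulf_neq0 //; split=> //; field; apply/andP.
Qed.

Lemma simpleN u : E u -> E (- u).
Proof.
by move=> Eu; rewrite -mulN1r -(rmorphN1 iota); apply: simpleM => //; apply: simpleC.
Qed.

Lemma simpleV u : E u -> E u^-1.
Proof.
move=> [p [q [q0 ->]]]; rewrite invf_div.
have [->|p0] := eqVneq (map_poly iota p).[f] 0; last by exists q, p.
by rewrite invr0 mulr0; have := simpleC 0; rewrite rmorph0.
Qed.

Lemma simpleX u q : E u -> E (u ^+ q).
Proof.
move=> Eu; elim: q => [|q IHq]; last by rewrite exprS; apply: simpleM.
by have := simpleC 1; rewrite rmorph1.
Qed.

End SimpleSubfield.

(** Projection from the point (0 : 1 : zeta) of the curve, zeta^4 = -1, is the
    function f = y - zeta x.  Lines through that point meet the curve in three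
    further points, so that x is a root of a cubic over K(f). *)
Section QuarticPencil.
Variables (K : closedFieldType) (lam : 'I_2.-1 -> K).
Hypothesis four : 4%:R != 0 :> K.
Hypothesis lam1 : lam ord0 = 1.
Local Notation V := (fermat_curve (n := 2) 4 lam).
Variables (L : fieldType) (iota : {rmorphism K -> L}) (w : 'I_3 -> L).
Hypothesis hL : is_function_field iota V w.
Variable zeta : K.
Hypothesis zeta4 : zeta ^+ 4 = -1.

Local Notation x := (coord_x w : L).
Local Notation y := (coord_y w (ord0 : 'I_2.-1)).
Local Notation z := (iota zeta).
Let f := y - z * x.
Let n2 : (1 < 2)%N := isT.

Lemma zeta_neq0 : zeta != 0.
Proof.
by apply: contraTneq isT => E; move/eqP: zeta4; rewrite E expr0n eq_sym oppr_eq0 oner_eq0.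
Qed.

Lemma z4 : z ^+ 4 = -1. Proof. by rewrite -rmorphXn zeta4 rmorphN1. Qed.

Lemma fourL : 4%:R != 0 :> L. Proof. by rewrite -(rmorph_nat iota) fmorph_eq0. Qed.

Lemma lead_neq0 : 4%:R * z ^+ 3 != 0.
Proof. by rewrite mulf_neq0 ?fourL // expf_neq0 // fmorph_eq0 zeta_neq0. Qed.

Lemma pencil_cubic :
  4%:R * z ^+ 3 * f * x ^+ 3 + 6%:R * z ^+ 2 * f ^+ 2 * x ^+ 2
  + 4%:R * z * f ^+ 3 * x + (1 + f ^+ 4) = 0.
Proof.
have := fermat_xy n2 four hL ord0; rewrite lam1 rmorph1 => E.
have -> : 4%:R * z ^+ 3 * f * x ^+ 3 + 6%:R * z ^+ 2 * f ^+ 2 * x ^+ 2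
  + 4%:R * z * f ^+ 3 * x + (1 + f ^+ 4)
  = (1 + x ^+ 4 + y ^+ 4) - (1 + z ^+ 4) * x ^+ 4 by rewrite /f; ring.
by rewrite E z4 subrr mul0r subr0.
Qed.

Lemma pencil_neq0 : f != 0.
Proof.
apply/negP => /eqP f0; have := pencil_cubic; rewrite f0.
by rewrite !expr0n /= !(mulr0, mul0r) !(add0r, addr0) => /eqP; rewrite oner_eq0.
Qed.

(** The abscissas of the points of the curve on the line y = t + zeta x. *)
Definition fiber_cubic (t : K) : {poly K} :=
  Poly [:: 1 + t ^+ 4; 4%:R * zeta * t ^+ 3; 6%:R * zeta ^+ 2 * t ^+ 2; 4%:R * zeta ^+ 3 * t].

Lemma fiber_cubicE t a : (fiber_cubic t).[a] =
  4%:R * zeta ^+ 3 * t * a ^+ 3 + 6%:R * zeta ^+ 2 * t ^+ 2 * a ^+ 2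
  + 4%:R * zeta * t ^+ 3 * a + (1 + t ^+ 4).
Proof. by rewrite horner_Poly /=; ring. Qed.

Lemma fiber_cubic_deriv t a : (fiber_cubic t)^`().[a] = 4%:R * zeta * t *
  (3%:R * (zeta * a) ^+ 2 + 3%:R * (zeta * a) * t + t ^+ 2).
Proof.
have -> : fiber_cubic t = (1 + t ^+ 4)%:P + (4%:R * zeta * t ^+ 3) *: 'X
  + (6%:R * zeta ^+ 2 * t ^+ 2) *: 'X^2 + (4%:R * zeta ^+ 3 * t) *: 'X^3.
  apply/polyP => i; rewrite coef_Poly !coefD !coefZ coefC coefX !coefXn.
  by case: i => [|[|[|[|i]]]] /=; rewrite ?nth_nil; ring.
rewrite !derivD !derivZ derivC derivX !derivXn.
by rewrite !hornerE /=; ring.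
Qed.

(** Up to a constant and powers of t, the discriminant of the cubic is t^8 + 27. *)
Lemma fiber_roots t : t * (t ^+ 8 + 27%:R) != 0 ->
  exists rs, [/\ uniq rs, (2 < size rs)%N & all (root (fiber_cubic t)) rs].
Proof.
rewrite mulf_eq0 negb_or => /andP[t0 t8].
have l0 : 4%:R * zeta ^+ 3 * t != 0 by rewrite !mulf_neq0 ?expf_neq0 ?zeta_neq0.
have [a|rs [urs srs allr]] := @distinct_roots _ (fiber_cubic t).
  rewrite rootE fiber_cubicE => /eqP B; rewrite fiber_cubic_deriv.
  rewrite !mulf_neq0 ?zeta_neq0 //; apply: contraNneq t8 => A.
  (* Eliminating s = zeta a from the cubic and its derivative: 3 times the cubic
     reduces modulo the derivative to [R], and then t^8 + 27 is a combination of
     both.  No division by 3 occurs, so characteristic 3 is covered. *)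
  set s := zeta * a in A.
  have {}B : 4%:R * t * s ^+ 3 + 6%:R * t ^+ 2 * s ^+ 2 + 4%:R * t ^+ 3 * s + (1 + t ^+ 4) = 0.
    by rewrite -[RHS]B /s; ring.
  have R : 2%:R * t ^+ 3 * s + t ^+ 4 + 3%:R = 0.
    have -> : 2%:R * t ^+ 3 * s + t ^+ 4 + 3%:R =
      3%:R * (4%:R * t * s ^+ 3 + 6%:R * t ^+ 2 * s ^+ 2 + 4%:R * t ^+ 3 * s + (1 + t ^+ 4))
      - (4%:R * t * s + 2%:R * t ^+ 2) * (3%:R * s ^+ 2 + 3%:R * s * t + t ^+ 2) by ring.
    by rewrite A B; ring.
  have -> : t ^+ 8 + 27%:R = 4%:R * t ^+ 6 * (3%:R * s ^+ 2 + 3%:R * s * t + t ^+ 2)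
    - 3%:R * (2%:R * t ^+ 3 * s + t ^+ 4 - 3%:R) * (2%:R * t ^+ 3 * s + t ^+ 4 + 3%:R) by ring.
  by rewrite A R !mulr0 subrr.
exists rs; split=> //; rewrite srs.
by rewrite (@PolyK _ 0).
Qed.

Definition at_pencil (p : {poly K}) (q : {mpoly K[3]}) : {mpoly K[3]} :=
  \sum_(i < size p) p`_i *: q ^+ i.

(** For a general value t of f, the relation evaluates at the three points of the
    fibre to a quadratic polynomial with three roots. *)
Lemma pencil_free (p0 p1 p2 : {poly K}) :
    (map_poly iota p0).[f] + (map_poly iota p1).[f] * x + (map_poly iota p2).[f] * x ^+ 2 = 0 ->
  [/\ p0 = 0, p1 = 0 & p2 = 0].
Proof.
move=> rel; have w0 := w0_neq0 n2 four hL.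
pose X : {mpoly K[3]} := 'X_(inord 1); pose Y : {mpoly K[3]} := 'X_(inord 2).
pose F := Y - zeta *: X.
pose g := at_pencil p0 F + at_pencil p1 F * X + at_pencil p2 F * X ^+ 2.
pose wa i := w i / w ord0.
have XE : evalL iota wa X = x by rewrite evalLX /wa /coord_x inord0E.
have FE : evalL iota wa F = f.
  by rewrite /F -scaleNr evalLD evalLZ XE evalLX rmorphN mulNr /wa /f /coord_y inord0E.
have atE p : evalL iota wa (at_pencil p F) = (map_poly iota p).[f].
  rewrite evalL_sum horner_coef size_map_poly; apply: eq_bigr => i _.
  by rewrite evalLZ evalLXn FE coef_map.
have g0 : evalL iota wa g = 0.
  by rewrite /g !evalLD !evalLM !atE XE; exact: rel.
have at_t t : t * (t ^+ 8 + 27%:R) != 0 -> [/\ p0.[t] = 0, p1.[t] = 0 & p2.[t] = 0].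
  move=> /fiber_roots[rs [urs srs allr]]; apply: quadratic_3roots urs srs _.
  apply: sub_all allr => a; rewrite rootE fiber_cubicE => /eqP aE.
  pose P := affine_pt (n := 2) a (fun=> t + zeta * a).
  have VP : V P.
    apply: affine_ptP => // j; rewrite (ord1 j) lam1.
    apply/eqP; rewrite -addr_eq0; apply/eqP; rewrite -[RHS]addr0 -{1}aE.
    have -> : 0 = (1 + zeta ^+ 4) * a ^+ 4 by rewrite zeta4 subrr mul0r.
    ring.
  have PX : X.@[P] = a by rewrite mevalXU; apply: (affine_pt1 n2).
  have PF : F.@[P] = t.
    rewrite mevalB mevalZ PX mevalXU.
    by have -> : P (inord 2) = t + zeta * a := affine_pt2 n2 _ _ ord0; rewrite addrK.
  have Pat p : (at_pencil p F).@[P] = p.[t].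
    rewrite raddf_sum horner_coef; apply: eq_bigr => i _.
    by rewrite /= mevalZ rmorphXn /= PF.
  have := affine_vanish hL w0 g0 VP (affine_pt0 _ _).
  by rewrite !mevalD !mevalM !Pat PX => E; rewrite -[X in _ == X]E expr2.
have q0 : 'X * ('X^8 + 27%:R%:P) != 0 :> {poly K}.
  rewrite mulf_neq0 ?polyX_eq0 // -lead_coef_eq0 lead_coefDl ?lead_coefXn ?oner_eq0 //.
  by rewrite size_polyXn (leq_ltn_trans (size_polyC_leq1 _)).
split; apply: (closed_poly0 q0) => t;
  by rewrite hornerM hornerX hornerD hornerXn hornerC => qt; case: (at_t t qt).
Qed.

Lemma pencil_transc p : p != 0 -> (map_poly iota p).[f] != 0.
Proof.
apply: contraNneq => p0; have [|-> //] := @pencil_free p 0 0.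
by rewrite rmorph0 horner0 !mul0r !addr0.
Qed.

Local Notation E := (in_simple_subfield iota f).

(** The K(f)-span of 1, x, x^2; it turns out to be the whole function field. *)
Definition span3 (u : L) : Prop :=
  exists a b c, [/\ E a, E b, E c & u = a + b * x + c * x ^+ 2].

Let E0 : E 0. Proof. by have := simpleC iota f 0; rewrite rmorph0. Qed.
Let E1 : E 1. Proof. by have := simpleC iota f 1; rewrite rmorph1. Qed.

Lemma span3_base a : E a -> span3 a.
Proof. by move=> Ea; exists a, 0, 0; split=> //; rewrite !mul0r !addr0. Qed.

Lemma span3_x : span3 x.
Proof. by exists 0, 1, 0; split=> //; rewrite mul0r mul1r add0r addr0. Qed.

Lemma span3D u v : span3 u -> span3 v -> span3 (u + v).
Proof.
move=> [a [b [c [Ea Eb Ec ->]]]] [a' [b' [c' [Ea' Eb' Ec' ->]]]].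
by exists (a + a'), (b + b'), (c + c'); split; try exact: simpleD; ring.
Qed.

Lemma span3Z a u : E a -> span3 u -> span3 (a * u).
Proof.
move=> Ea [a' [b' [c' [Ea' Eb' Ec' ->]]]].
by exists (a * a'), (a * b'), (a * c'); split; try exact: simpleM; ring.
Qed.

Lemma span3_mulx u : span3 u -> span3 (x * u).
Proof.
move=> [a [b [c [Ea Eb Ec ->]]]].
have x3 : span3 (x ^+ 3).
  have l0 : 4%:R * z ^+ 3 * f != 0 by rewrite mulf_neq0 ?lead_neq0 ?pencil_neq0.
  have Ef := simple_gen iota f; have EC := simpleC iota f.
  have En q : E q%:R by rewrite -(rmorph_nat iota).
  exists (- (1 + f ^+ 4) / (4%:R * z ^+ 3 * f)),
    (- (4%:R * z * f ^+ 3) / (4%:R * z ^+ 3 * f)),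
    (- (6%:R * z ^+ 2 * f ^+ 2) / (4%:R * z ^+ 3 * f)).
  have EV : E (4%:R * z ^+ 3 * f)^-1.
    by apply/simpleV/simpleM => //; apply/simpleM => //; apply: simpleX.
  split.
  - apply: simpleM => //; apply: simpleN.
    by apply: simpleD => //; apply: simpleX.
  - apply: simpleM => //; apply: simpleN.
    by apply: simpleM; [apply: simpleM | apply: simpleX].
  - apply: simpleM => //; apply: simpleN.
    by apply: simpleM; [apply: simpleM => //; apply: simpleX | apply: simpleX].
  apply: (mulfI l0); apply/eqP; rewrite -subr_eq0; apply/eqP.
  rewrite -[RHS]pencil_cubic; field.
  by rewrite pencil_neq0 fmorph_eq0 zeta_neq0 fourL.
have -> : x * (a + b * x + c * x ^+ 2) = (0 + a * x + b * x ^+ 2) + c * x ^+ 3 by ring.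
by apply: span3D; [exists 0, a, b | apply: span3Z].
Qed.

Lemma span3M u v : span3 u -> span3 v -> span3 (u * v).
Proof.
move=> [a [b [c [Ea Eb Ec ->]]]] Wv.
have -> : (a + b * x + c * x ^+ 2) * v = a * v + b * (x * v) + c * (x * (x * v)) by ring.
by apply: span3D; [apply: span3D|]; apply: span3Z => //; do ?apply: span3_mulx.
Qed.

Lemma commr_f : commr_rmorph iota f. Proof. by move=> a; apply: mulrC. Qed.

Local Notation H := (horner_morph commr_f).

(** A nonzero integral element divides the lowest nonzero coefficient of an
    integral equation.  That coefficient is a nonzero element of K[f], and the
    quotient, a polynomial in [u], stays in the span. *)
Lemma span3_inv u : u != 0 -> span3 u -> integralOver H u -> span3 u^-1.
Proof.
move=> u0 Wu [p pmon]; have := monic_neq0 pmon; elim/poly_ind: p {pmon} => [|p c IHp].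
  by rewrite eqxx.
move=> pc0; rewrite rootE rmorphD rmorphM /= map_polyX map_polyC /= hornerMXaddC.
have Wp (q : {poly {poly K}}) : span3 (map_poly H q).[u].
  elim/poly_ind: q => [|q a IHq]; first by rewrite rmorph0 horner0; apply: span3_base.
  rewrite rmorphD rmorphM /= map_polyX map_polyC /= hornerMXaddC.
  by apply: span3D; [apply: span3M | apply/span3_base/simple_poly].
have [c0|c0] := eqVneq c 0.
  rewrite c0 rmorph0 addr0 mulf_eq0 (negbTE u0) orbF => pu.
  by apply: IHp => //; apply: contraNneq pc0 => ->; rewrite c0 mul0r addr0.
have Hc : H c != 0 by apply: pencil_transc.
rewrite addr_eq0 => /eqP pu.
have -> : u^-1 = - (H c)^-1 * (map_poly H p).[u].
  by apply: (mulIf u0); rewrite mulVf // -mulrA pu mulrNN mulVf.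
by apply: span3Z => //; apply/simpleN/simpleV/simple_poly.
Qed.

Lemma integralC c : integralOver H (iota c).
Proof.
have <- : H c%:P = iota c by rewrite /horner_morph map_polyC hornerC.
exact: integral_id.
Qed.

Lemma integral_f : integralOver H f.
Proof.
have XE : H 'X = f by rewrite /horner_morph map_polyX hornerX.
by have := integral_id H 'X; rewrite [X in integralOver _ X]XE.
Qed.

Lemma integralX u q : integralOver H u -> integralOver H (u ^+ q).
Proof.
move=> Iu; elim: q => [|q IHq]; first exact: integral1.
by rewrite exprS; apply: integral_mul.
Qed.

(** x itself is not integral over K[f], since the leading coefficient of its cubic is a
    multiple of f; multiplication by f repairs this. *)
Lemma integral_fx : integralOver H (f * x).
Proof.
pose c := (4%:R * zeta ^+ 3)^-1; pose ic := iota c.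
have cE : ic * (4%:R * z ^+ 3) = 1.
  by rewrite /ic /c fmorphV rmorphM rmorphXn rmorph_nat mulVf // lead_neq0.
pose s := [:: ic * ((1 + f ^+ 4) * f ^+ 2); ic * (4%:R * z * f ^+ 4);
              ic * (6%:R * z ^+ 2 * f ^+ 2); 1].
have sE : Poly s = s :> seq L by rewrite (@PolyK _ 0) //= oner_eq0.
have If := integral_f; have IC := integralC.
have In q : integralOver H q%:R by exact: integral_nat.
apply: (@integral_root_monic _ _ _ _ (Poly s)).
- by rewrite monicE lead_coefE sE.
- rewrite rootE horner_Poly /=; apply/eqP.
  have -> : ((((0 * (f * x) + 1) * (f * x) + ic * (6%:R * z ^+ 2 * f ^+ 2)) * (f * x)
    + ic * (4%:R * z * f ^+ 4)) * (f * x) + ic * ((1 + f ^+ 4) * f ^+ 2)) =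
    (1 - ic * (4%:R * z ^+ 3)) * (f * x) ^+ 3 + ic * f ^+ 2 *
    (4%:R * z ^+ 3 * f * x ^+ 3 + 6%:R * z ^+ 2 * f ^+ 2 * x ^+ 2
      + 4%:R * z * f ^+ 3 * x + (1 + f ^+ 4)) by ring.
  by rewrite cE pencil_cubic subrr mul0r mulr0 addr0.
have Ic : integralOver H ic := integralC _; have Iz := integralC zeta.
have mul := integral_mul; have pow := integralX.
move=> u; rewrite sE !inE => /or4P[] /eqP ->; last exact: integral1.
- apply: (mul) Ic _; apply: (mul); last exact: pow.
  by apply: integral_add; [apply: integral1 | apply: (pow)].
- by apply: (mul) Ic _; apply: (mul); [apply: (mul) | apply: (pow)].
- apply: (mul) Ic _; apply: (mul); last exact: pow.
  by apply: (mul) => //; apply: (pow).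
Qed.

Lemma pencil_trigonal : degree_over iota f 3.
Proof.
exists (fun i : 'I_3 => x ^+ i); split; last first.
  move=> c Ec sum0.
  have [p0 [q0 [q0n c0]]] := Ec (@Ordinal 3 0 isT).
  have [p1 [q1 [q1n c1]]] := Ec (@Ordinal 3 1 isT).
  have [p2 [q2 [q2n c2]]] := Ec (@Ordinal 3 2 isT).
  have [|a0 a1 a2] := @pencil_free (p0 * (q1 * q2)) (p1 * (q0 * q2)) (p2 * (q0 * q1)).
    set s := (\sum_(i < 3) _) in sum0.
    have sE : s = c (@Ordinal 3 0 isT) + c (@Ordinal 3 1 isT) * x
              + c (@Ordinal 3 2 isT) * x ^+ 2.
      rewrite /s !big_ord_recl big_ord0 addr0 addrA expr0 mulr1.
      by congr (c _ + c _ * _ + c _ * _); try exact: val_inj.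
    have : (map_poly iota q0).[f] * (map_poly iota q1).[f] * (map_poly iota q2).[f] * s = 0.
      by rewrite sum0 mulr0.
    rewrite sE c0 c1 c2 !rmorphM /= !hornerM => <-; field.
    by rewrite q0n q1n q2n.
  have nz q : (map_poly iota q).[f] != 0 -> q != 0.
    by apply: contraNneq => ->; rewrite rmorph0 horner0.
  have z0 (p q : {poly K}) : p * q = 0 -> q != 0 -> p = 0.
    by move=> /eqP; rewrite mulf_eq0 => /orP[/eqP //|/eqP ->]; rewrite eqxx.
  have {a0} a0 := z0 _ _ a0 (mulf_neq0 (nz _ q1n) (nz _ q2n)).
  have {a1} a1 := z0 _ _ a1 (mulf_neq0 (nz _ q0n) (nz _ q2n)).
  have {a2} a2 := z0 _ _ a2 (mulf_neq0 (nz _ q0n) (nz _ q1n)).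
  rewrite a0 rmorph0 horner0 mul0r in c0; rewrite a1 rmorph0 horner0 mul0r in c1.
  rewrite a2 rmorph0 horner0 mul0r in c2.
  move=> [[|[|[|//]]] i3]; [rewrite -[RHS]c0 | rewrite -[RHS]c1 | rewrite -[RHS]c2];
    by congr c; apply: val_inj.
move=> u; have w0 := w0_neq0 n2 four hL.
(* Homogeneous coordinates (f : f x : f y) of the generic point: they are integral
   over K[f], so the value of any form is. *)
pose v i := f / w ord0 * w i.
have vW i : span3 (v i) /\ integralOver H (v i).
  have Wf : span3 f by apply/span3_base/simple_gen.
  case: (coordinate_cases n2 i) => [->|->|[j ->]].
  - by rewrite /v divfK //; split=> //; apply: integral_f.
  - have -> : v (inord 1) = f * x by rewrite /v /coord_x inord0E; field.
    by split; [apply: span3M => //; apply: span3_x | apply: integral_fx].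
  have -> : v (inord j.+2) = f * f + z * (f * x).
    rewrite (ord1 j); have -> : f * f + z * (f * x) = f * y by rewrite /f; ring.
    by rewrite /v /coord_y inord0E; field.
  split.
    apply: span3D; first exact: span3M.
    by apply: span3M; [apply/span3_base/simpleC | apply: span3M => //; apply: span3_x].
  apply: integral_add; first by apply: integral_mul; apply: integral_f.
  by apply: integral_mul; [apply: integralC | apply: integral_fx].
have vFW F : span3 (evalL iota v F) /\ integralOver H (evalL iota v F).
  rewrite evalLE; elim/big_rec: _ => [|m s _ [Ws Is]].
    by split; [apply: span3_base | apply: integral0].
  suff [Wm Im] : span3 (\prod_i v i ^+ m i) /\ integralOver H (\prod_i v i ^+ m i).
    split; first by apply: span3D => //; apply: span3Z => //; apply: simpleC.
    by apply: integral_add => //; apply: integral_mul => //; apply: integralC.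
  elim/big_rec: _ => [|i r _ [Wr Ir]].
    by split; [apply: span3_base | apply: integral1].
  suff [Wi Ii] : span3 (v i ^+ m i) /\ integralOver H (v i ^+ m i).
    by split; [apply: span3M | apply: integral_mul].
  have [Wv Iv] := vW i; split; last exact: integralX.
  by elim: (m i) => [|q IHq]; [apply: span3_base | rewrite exprS; apply: span3M].
have [d [F [G [Fh Gh G0 uE]]]] := hL.2 u.
have f0 : (f / w ord0) ^+ d != 0.
  by rewrite expf_neq0 // mulf_neq0 ?invr_eq0 // pencil_neq0.
have {}uE : u = evalL iota v F / evalL iota v G.
  by rewrite !(evalL_scale iota w _ Fh, evalL_scale iota w _ Gh) uE; field; apply/andP.
have G0' : evalL iota v G != 0 by rewrite (evalL_scale iota w _ Gh) mulf_neq0.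
have [a [b [c [Ea Eb Ec E3]]]] : span3 u.
  rewrite uE; apply: span3M; first exact: (vFW F).1.
  by have [WG IG] := vFW G; apply: span3_inv.
exists (fun i : 'I_3 => nth 0 [:: a; b; c] i); split.
  by move=> [[|[|[|//]]] i3].
by rewrite E3 !big_ord_recl big_ord0 addr0 addrA expr0 mulr1.
Qed.

End QuarticPencil.

(** * The Fermat quintic *)

Lemma proj_eq_refl (K : fieldType) N (P : 'I_N.+1 -> K) : proj_eq P P.
Proof. by exists 1; [apply: oner_neq0 | move=> i; rewrite mul1r]. Qed.

Lemma id_morphism (K : fieldType) N (V W : ('I_N.+1 -> K) -> Prop) :
    (forall P, V P -> W P) -> (forall P, V P -> exists i, P i != 0) ->
  proj_morphism V W id.
Proof.
move=> VW nz; split=> // P /nz[i Pi].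
exists 1%N, (fun j => 'X_j); split.
- by move=> j; rewrite dhomogX /= mdeg1.
- by exists i; rewrite mevalXU.
by move=> Q _ _; exists 1; [apply: oner_neq0 | move=> j; rewrite mevalXU mul1r].
Qed.

Lemma mderiv_exp (R : comNzRingType) m (P : 'I_m -> R) i j q :
  (mderiv i ('X_j ^+ q.+1)).@[P] = (i == j)%:R * (q.+1%:R * P j ^+ q).
Proof.
have UU : (U_(j) - U_(j) = 0 :> 'X_{1..m})%MM.
  by apply/mnmP => l; rewrite mnmBE subnn mnm0E.
elim: q => [|q IHq].
  rewrite expr1 mderivX mevalZ mnm1E eq_sym; case: eqP => [->|_]; last by rewrite !mul0r.
  by rewrite UU mevalX big1 ?expr0 ?mulr1 // => l _; rewrite mnm0E expr0.
rewrite exprS mderivM mevalD !mevalM IHq mderivX mevalZ mnm1E mevalXU rmorphXn /= mevalXU.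
rewrite (eq_sym j i); case: eqP => [->|_]; last by rewrite !mul0r mulr0 addr0.
rewrite UU mevalX big1 => [|l _]; last by rewrite mnm0E expr0.
by rewrite !exprS -[q.+2%:R]natr1; ring.
Qed.

Lemma fermat_quintic_plane (K : closedFieldType) (lam : 'I_2.-1 -> K) :
  5%:R != 0 :> K -> lam ord0 = 1 -> plane_quintic (fermat_curve (n := 2) 5 lam).
Proof.
move=> five lam1; pose G := fermat_eq (n := 2) 5 lam ord0.
have GE (P : 'I_3 -> K) :
    G.@[P] = P (inord 0) ^+ 5 + P (inord 1) ^+ 5 + P (inord 2) ^+ 5.
  by rewrite fermat_eqE lam1 mul1r.
have VG P : fermat_curve (n := 2) 5 lam P <-> zero_locus (fun g => g = G) P.
  split=> -[nz van]; split=> // g; first by move=> ->; apply: van; exists ord0.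
  by move=> [i ->]; rewrite (ord1 i); apply: van.
have dG (P : 'I_3 -> K) i : (mderiv i G).@[P] = 5%:R * P i ^+ 4.
  have cases : [\/ i = inord 0, i = inord 1 | i = inord 2].
    by case: (@coordinate_cases 2 isT i) => [->|->|[j ->]]; rewrite ?(ord1 j);
      [rewrite -inord0E; constructor 1 | constructor 2 | constructor 3].
  have ne a b : (a < 3)%N -> (b < 3)%N -> (inord a == inord b :> 'I_3) = (a == b).
    by move=> a3 b3; rewrite -val_eqE /= !inordK.
  rewrite /G /fermat_eq lam1 scale1r !mderivD !mevalD !mderiv_exp.
  by case: cases => ->; rewrite !ne //= ?mul1r ?mul0r ?addr0 ?add0r.
exists G; split.
- exact: fermat_eq_homog.
- move=> P [i Pi] _; exists i; rewrite dG.
  by rewrite mulf_neq0 // expf_neq0.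
exists id, id; split.
- by apply: id_morphism => P; [move/VG | case].
- by apply: id_morphism => P; [move/VG | case].
- by move=> P _; apply: proj_eq_refl.
- by move=> P _; apply: proj_eq_refl.
Qed.

Theorem theorem5 (K : closedFieldType) (k n : nat)
    (hk : (2 <= k)%N) (hn : (2 <= n)%N)
    (hchar : forall p, p \in [pchar K] -> ~~ (p %| k)%N)
    (lam : 'I_n.-1 -> K)
    (hlam1 : forall i : 'I_n.-1, nat_of_ord i = 0%N -> lam i = 1)
    (hlam0 : forall i, lam i != 0)
    (hlam_inj : injective lam)
    (L : fieldType) (iota : {rmorphism K -> L}) (w : 'I_n.+1 -> L)
    (hL : is_function_field iota (fermat_curve k lam) w)
    (hgenus : (2 < n.-1 * k.-1)%N)
    (htrig : ~ trigonal iota)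
    (hquint : ~ plane_quintic (fermat_curve k lam)) :
  (forall f : {mpoly K[#|{: index1 k n}|]},
     canonical_ring iota (fermat_curve k lam) w (coord_x w)
       (canonical_map iota w f)) /\
  (forall f : {mpoly K[#|{: index1 k n}|]},
     canonical_map iota w f = 0 <->
     in_ideal_gen (fun g => Gbi g \/ Gtri lam g) f).
Proof.
have kK : k%:R != 0 :> K.
  apply/negP => k0; have [p pK] := natf0_pchar (ltnW hk) k0.
  by have := hchar p pK; rewrite (dvdn_pcharf pK) k0.
(* For n = 2 the genus condition gives k >= 4; the values 4 and 5 contradict
   the last two hypotheses. *)
have not_special : n.-1 = 1%N -> (4 < k.-1)%N.
  move=> n1; rewrite ltnNge; apply/negP => k4.
  have nE : n = 2%N by lia.
  subst n; have lam1 : lam ord0 = 1 by apply: hlam1.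
  have [kE|kE] : k = 4%N \/ k = 5%N by lia.
    subst k; apply: htrig; have [zeta zeta4] := kth_root_exists kK (-1).
    by exists (coord_y w ord0 - iota zeta * coord_x w); apply: pencil_trigonal hL zeta zeta4.
  by subst k; apply/hquint/fermat_quintic_plane.
have y0 := y_neq0 hn kK hL hlam0.
have rel := fermat_xy hn kK hL.
split=> f; first exact: canonical_map_regular.
split; last exact: quadric_ideal_in_kernel.
apply: (kernel_in_quadric_ideal y0 hk rel hgenus not_special).
by move=> A c; apply: (monomials_free hn kK hL hlam0).
Qed.
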